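(* Consider the $m$-hypergeometric system with local exponents $a_1,a_2$; $b_1,\dots,b_m$; $-c_1,\dots,-c_m$, its monodromy operators $M_0,M_1,M_\infty$ acting on its $m$-dimensional space of solutions, and the normalized eigenvectors $p_i$ of $M_0$ and $q_i$ of $M_\infty$ defined in the context. If all the local exponents are real, then there exists a unique up to a constant multiple monodromy invariant hermitian product $(\cdot,\cdot)_{trig}$ on the space of solutions such that the bases $p_1,\dots,p_m$ and $q_1,\dots,q_m$ are simultaneously orthogonal with respect to it, given by $$(p_i,p_j)_{trig}=\delta_{ij}\,\nu_{i\,trig}^2,\qquad (q_i,q_j)_{trig}=\delta_{ij}\,\mu_{i\,trig}^2,$$ where $$\mu_{i\,trig}^2=\frac{\prod_{k=1}^m\sin\pi(a_2+b_k-c_i)}{\prod_{k\ne i}\sin\pi(c_k-c_i)},\qquad \nu_{i\,trig}^2=\frac{\prod_{k=1}^m\sin\pi(a_2+b_i-c_k)}{\prod_{k\neq i}\sin\pi(b_i-b_k)} .$$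
   Context: Let $A,B,C$ be linear operators on $\mathbb{C}^m$ with $A+B+C=0$, $\operatorname{rank}B=\operatorname{rank}C=m$, $A$ diagonalizable with two different eigenvalues $a_1$ (multiplicity $1$) and $a_2$ (multiplicity $m-1$), $B$ with eigenvalues $b_1,\dots,b_m$, $C$ with eigenvalues $-c_1,\dots,-c_m$, generic within these restrictions (so the eigenvalues are generic subject to the trace condition $a_1+(m-1)a_2+\sum_i(b_i-c_i)=0$; in particular $b_i-b_j,\ c_i-c_j\notin\mathbb{Z}$ for $i\ne j$ and $b_i-c_j\notin\mathbb{Z}$ for all $i,j$). The $m$-hypergeometric system is the Fuchsian system $\frac{df}{dz}=\left[\frac{A}{z-1}+\frac{B}{z}\right]f$ on $\mathbb{CP}^1\setminus\{0,1,\infty\}$ with values in $\mathbb{C}^m$; the numbers $a_1,a_2,b_i,-c_i$ are its local exponents at $1,0,\infty$. Its monodromy operators $M_0,M_1,M_\infty$ around $0,1,\infty$ satisfy $M_\infty M_1M_0=\mathrm{Id}$. $M_0$ has eigenvalues $e^{2\pi\sqrt{-1}\,b_i}$, $M_\infty$ has eigenvalues $e^{-2\pi\sqrt{-1}\,c_i}$, and $M_1$ is diagonalizable with eigenvalue $e^{2\pi\sqrt{-1}\,a_1}$ of multiplicity $1$ and $e^{2\pi\sqrt{-1}\,a_2}$ of multiplicity $m-1$. Let $p_i$, $q_i$ be eigenvectors of $M_0$, $M_\infty$ for $e^{2\pi\sqrt{-1}\,b_i}$, $e^{-2\pi\sqrt{-1}\,c_i}$ respectively, and $r$ an eigenvector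 of $M_1$ for $e^{2\pi\sqrt{-1}\,a_1}$; by genericity the $p_i,q_i$ can be uniquely scaled so that $\sum_i p_i=\sum_i q_i=r$, and this scaling is fixed. *)

(* Defs.v *)
From HB Require Import structures.
From mathcomp Require Import all_boot all_order all_algebra.
From mathcomp Require Import all_classical all_reals all_analysis.
From mathcomp Require Import complex.

Set Implicit Arguments.
Unset Strict Implicit.
Unset Printing Implicit Defensive.

Import Order.TTheory GRing.Theory Num.Theory.
Import numFieldNormedType.Exports.

Local Open Scope classical_set_scope.
Local Open Scope ring_scope.
Local Open Scope complex_scope.

Section Fuchsian.
Context {R : realType} {m : nat}.
Implicit Types (A B : 'M[R[i]]_m) (f g : R[i] -> 'cV[R[i]]_m) (z : R[i]).

(* R[i]^o carries the topology and the norm of R[i]; since its scalars are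
   complex, the derivative in the direction 1 is the complex derivative. *)
Definition solves_at A B f z : Prop :=
  is_derive (z : R[i]^o) (1 : R[i]^o) (f : R[i]^o -> 'cV[R[i]]_m)
    (((z - 1)^-1 *: A + z^-1 *: B) *m f z).

Definition base_point : R[i] := 2^-1.

Definition base_disc : set R[i] := [set z | `|z - base_point| < 2^-1].

(* A branch at the base point is a solution on the base disc, the largest disc
   centred there that avoids 0 and 1; its junk values off the disc are set to 0,
   so that Leibniz equality of branches is equality on the disc. *)
Definition is_branch A B f : Prop :=
  (forall z, base_disc z -> solves_at A B f z) /\
  (forall z, ~ base_disc z -> f z = 0).

Definition branch_pred A B : {pred R[i] -> 'cV[R[i]]_m} :=
  fun f => `[< is_branch A B f >].

Fact branch_submod_closed A B : submod_closed (branch_pred A B).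
Proof.
split.
  apply/asboolP; split=> // z _.
  by rewrite /solves_at mulmx0; exact: is_derive_cst.
move=> a f g /asboolP[sf f0] /asboolP[sg g0]; apply/asboolP; split=> z Dz.
  rewrite /solves_at mulmxDr -scalemxAr.
  have dfz := sf z Dz; have dgz := sg z Dz.
  by rewrite /solves_at in dfz dgz; exact: is_deriveD.
have -> : (a *: f + g) z = a *: f z + g z by [].
by rewrite f0 // g0 // scaler0 add0r.
Qed.

HB.instance Definition _ A B := GRing.isSubmodClosed.Build
  R[i] (R[i] -> 'cV[R[i]]_m) (branch_pred A B) (branch_submod_closed A B).

(* The space of solutions of df/dz = [A/(z-1) + B/z] f. *)
Record solution A B := Solution {
  solution_fun :> R[i] -> 'cV[R[i]]_m;
  _ : solution_fun \in branch_pred A B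
}.

HB.instance Definition _ A B := [isSub for @solution_fun A B].
HB.instance Definition _ A B := [Choice of solution A B by <:].
HB.instance Definition _ A B :=
  [SubChoice_isSubLmodule of solution A B by <:].

(* Analytic continuation along a path gamma : [0, 1] -> C \ {0, 1}: F t is the
   germ at gamma t, and germs at nearby times are restrictions of each other. *)
Definition continues_along A B (gamma : R -> R[i]) f g : Prop :=
  exists F : R -> R[i] -> 'cV[R[i]]_m,
    [/\ forall t : R, 0 <= t <= 1 ->
          \forall w \near (gamma t : R[i]^o), solves_at A B (F t) w,
        forall t : R, 0 <= t <= 1 ->
          \forall s \near t, 0 <= s <= 1 ->
            \forall w \near (gamma s : R[i]^o), F s w = F t w,
        \forall w \near (gamma 0 : R[i]^o), F 0 w = f w
      & \forall w \near (gamma 1 : R[i]^o), F 1 w = g w].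

Definition monodromy_operator A B (gamma : R -> R[i])
    (M : solution A B -> solution A B) : Prop :=
  forall f : solution A B, continues_along A B gamma f (M f).

End Fuchsian.

Section Loops.
Context {R : realType}.

Definition expi (x : R) : R[i] := cos x +i* sin x.

(* Counterclockwise loops around 0 and 1, based at base_point. *)
Definition loop0 (t : R) : R[i] := 2^-1 * expi (2 * pi * t).
Definition loop1 (t : R) : R[i] := 1 - 2^-1 * expi (2 * pi * t).

(* The loop around infinity is the inverse of "loop0, then loop1", the latter
   being homotopic to a simple counterclockwise loop enclosing 0 and 1: it runs
   through loop1 and then loop0, both backwards.  With operators composed as
   functions, this is the choice for which Moo M1 M0 = Id. *)
Definition loopoo (t : R) : R[i] :=
  if t <= 2^-1 then loop1 (1 - 2 * t) else loop0 (2 - 2 * t).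

End Loops.

Section Exponents.
Context {R : realType} {m : nat}.
Variables (a1 a2 : R) (b c : 'I_m -> R).

(* Explicit genericity conditions.  The first makes M1 diagonalizable; the last
   one makes the system irreducible, without which the eigenvectors p_i and q_i
   cannot be normalized to have the same sum r. *)
Definition generic_exponents : Prop :=
  [/\ a1 - a2 \isn't a Num.int,
      forall i j, i != j -> b i - b j \isn't a Num.int,
      forall i j, i != j -> c i - c j \isn't a Num.int,
      forall i j, b i - c j \isn't a Num.int
    & forall i j, a2 + b i - c j \isn't a Num.int].

Definition mu2_trig (i : 'I_m) : R :=
  (\prod_(k < m) sin (pi * (a2 + b k - c i))) /
  (\prod_(k < m | k != i) sin (pi * (c k - c i))).

Definition nu2_trig (i : 'I_m) : R :=
  (\prod_(k < m) sin (pi * (a2 + b i - c k))) /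
  (\prod_(k < m | k != i) sin (pi * (b i - b k))).

End Exponents.

Section Forms.
Context {R : realType} {V : lmodType R[i]}.

(* Hermitian sesquilinear forms, not assumed to be positive or nondegenerate. *)
Definition hermitian_product := {hermitian V for false & @Num.conj R[i]}.

Definition invariant_under (h : V -> V -> R[i]) (M : V -> V) : Prop :=
  forall u v, h (M u) (M v) = h u v.

Definition orthogonal_family {m} (h : V -> V -> R[i]) (e : 'I_m -> V) : Prop :=
  forall i j, i != j -> h (e i) (e j) = 0.

Definition eigenvector_of (M : V -> V) (x : R[i]) (v : V) : Prop :=
  v != 0 /\ M v = x *: v.

End Forms.

Arguments hermitian_product {R} V.

(* Main.v *)
(** Evaluation at the base point embeds the space of solutions into C^m.  Along a
    path, an analytic continuation is a solution of a linear real ODE, so that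
    Gronwall's inequality gives uniqueness, linearity of the monodromy operators
    and M1 M0 Moo = Id.

    M1 is a complex reflection.  The partial sums of the series
    (z-1)^a2 sum_n V_n (z-1)^n with V_0 = A - a1 are approximate solutions along
    the loop around 1, with an error that tends to 0.  Their values at the base
    point converge to a matrix L with (M1 - e^(2 pi i a2)) L = 0, and the kernel
    of L lies in that of A - a1, so that M1 - e^(2 pi i a2) has rank at most 1:
    M1 v = e^(2 pi i a2) v + l(v) r.

    In the basis p the eigenvector equations M1 M0 q_j = e^(2 pi i c_j) q_j then
    become two Cauchy linear systems, whose explicit solutions express l(p_i) and
    l(M0 q_j) as products of sines: l(p_i) = kappa nu_i^2 with one constant kappa.
    The diagonal form with entries nu_i^2 in the basis p is M1-invariant because
    e^(2 pi i a2) + kappa sum_i nu_i^2 = e^(2 pi i a1) has modulus 1.  Conversely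
    an invariant form diagonal in the basis p has entries proportional to l(p_i). *)

(* The obstacle is that nothing is known in advance about the space of solutions: a solution is a
   function on one disc, and the operators are maps characterized by continuation. Uniqueness bounds
   the dimension by m; that it equals m comes from the eigenvectors p_i, independent because their m
   eigenvalues are distinct, and not from an existence theorem for differential equations. Likewise
   the series at 1 is never summed to an exact solution, which would call for differentiation term
   by term and for a branch of (z-1)^a2. Its truncations are explicit functions of the time t, with
   e^(2 pi i a2 t) in place of the power, and stability of the equation under small defects does the
   rest. The series converges for |z-1| < 1 and the loop has radius 1/2, so a crude growth bound on
   the coefficients is enough. The q_i are not shown to be orthogonal by calculation: they are
   eigenvectors of the isometry [Moo] for distinct eigenvalues of modulus 1. Since they sum to r,
   their squared lengths are the products (q_i, r), which equal l(q_i) / kappa. *)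
Require Import Defs.
From HB Require Import structures.
From mathcomp Require Import all_boot all_order all_algebra.
From mathcomp Require Import all_classical all_reals all_analysis.
From mathcomp Require Import complex.
From mathcomp Require Import ring lra zify.

Set Implicit Arguments.
Unset Strict Implicit.
Unset Printing Implicit Defensive.

Import Order.TTheory GRing.Theory Num.Theory.
Import numFieldNormedType.Exports.
Import Normc.

Local Open Scope classical_set_scope.
Local Open Scope ring_scope.
Local Open Scope complex_scope.

Local Notation Re := complex.Re.
Local Notation Im := complex.Im.

(** * Derivatives of complex-valued functions of a real variable *)

Lemma is_derive1_epsP (K : numFieldType) (W : normedModType K) (f : K^o -> W)
    (z : K^o) (D : W) :
  is_derive z (1 : K^o) f D <->
  forall e : K, 0 < e ->
    \forall w \near z, `|f w - f z - (w - z) *: D| <= e * `|w - z|.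
Proof.
have E (w : K^o) : w - z != 0 -> `|D - (w - z)^-1 *: (f w - f z)| * `|w - z| =
    `|f w - f z - (w - z) *: D|.
  move=> wz; rewrite mulrC -normrZ scalerBr scalerA divff// scale1r.
  by rewrite distrC.
have S1 (h : K) : h *: (1 : K^o) = h := mulr1 h.
split=> [[df vf] e e0|H].
  have /cvgrPdist_le/(_ e e0) : h^-1 *: (f (h *: (1 : K^o) + z) - f z)
      @[h --> 0^'] --> D by rewrite -vf.
  move=> /nbhs_ballP[d d0 dP]; apply/nbhs_ballP; exists d => //= w zw.
  have [->|wz] := eqVneq w z; first by rewrite !subrr scale0r subr0 !normr0 mulr0.
  rewrite -E ?subr_eq0//; apply: ler_wpM2r => //.
  have := dP (w - z); rewrite /ball /= sub0r normrN distrC subr_eq0 => /(_ zw wz).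
  by rewrite S1 subrK.
have L : h^-1 *: (f (h *: (1 : K^o) + z) - f z) @[h --> 0^'] --> D.
  apply/cvgrPdist_le => e e0; have /nbhs_ballP[d d0 dP] := H e e0.
  apply/nbhs_ballP; exists d => //= h; rewrite /ball /= sub0r normrN => hd h0.
  have bz : ball z d (h + z) by rewrite /ball /= -opprB addrK normrN.
  by have := dP _ bz; rewrite -E addrK// S1 ler_pM2r ?normr_gt0.
by split; [apply: cvgP L | apply: cvg_lim L].
Qed.

Section ComplexNorm.
Context {R : realType}.
Implicit Types (x y z : R[i]).

Lemma complexReD x y : Re (x + y) = Re x + Re y.
Proof. by case: x y => [a b] [c d]. Qed.

Lemma complexImD x y : Im (x + y) = Im x + Im y.
Proof. by case: x y => [a b] [c d]. Qed.

Lemma complexReN x : Re (- x) = - Re x. Proof. by case: x. Qed.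

Lemma complexImN x : Im (- x) = - Im x. Proof. by case: x. Qed.

Lemma complexReM x y : Re (x * y) = Re x * Re y - Im x * Im y.
Proof. by case: x y => [a b] [c d]. Qed.

Lemma complexImM x y : Im (x * y) = Re x * Im y + Im x * Re y.
Proof. by case: x y => [a b] [c d]. Qed.

Lemma normcEC x : `|x| = (normc x)%:C. Proof. by []. Qed.

Lemma normc_ge0 x : 0 <= normc x.
Proof. by case: x => a b; exact: sqrtr_ge0. Qed.

Lemma normcD_le x y : normc (x + y) <= normc x + normc y.
Proof. by rewrite -lecR rmorphD/= -!normcEC ler_normD. Qed.

Lemma normc_opp x : normc (- x) = normc x.
Proof. by apply: complexI; rewrite -!normcEC normrN. Qed.

Lemma normc_real (r : R) : normc r%:C = `|r|.
Proof. by rewrite /= expr0n addr0 sqrtr_sqr. Qed.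

Lemma normc_sqr x : normc x ^+ 2 = Re x ^+ 2 + Im x ^+ 2.
Proof. by case: x => a b; rewrite sqr_sqrtr// addr_ge0// sqr_ge0. Qed.

Lemma Re_le_normc x : `|Re x| <= normc x.
Proof.
rewrite -ler_sqr ?nnegrE ?normc_ge0// normc_sqr real_normK ?num_real//.
by rewrite lerDl sqr_ge0.
Qed.

Lemma Im_le_normc x : `|Im x| <= normc x.
Proof.
rewrite -ler_sqr ?nnegrE ?normc_ge0// normc_sqr real_normK ?num_real//.
by rewrite lerDr sqr_ge0.
Qed.

Lemma normc_le x : normc x <= `|Re x| + `|Im x|.
Proof.
rewrite -ler_sqr ?nnegrE ?normc_ge0 ?addr_ge0// normc_sqr sqrrD.
by rewrite !real_normK ?num_real// lerD2r lerDl mulrn_wge0// mulr_ge0.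
Qed.

(** Radii of balls in [R[i]^o] are elements of [R[i]]; a positive one is a positive real, since
    comparable complex numbers have equal imaginary parts. *)
Lemma near_complexP z (P : R[i] -> Prop) :
  (\forall w \near (z : R[i]^o), P w) <->
  exists2 d : R, 0 < d & forall w, normc (w - z) < d -> P w.
Proof.
split=> [/nbhs_ballP[d /= d0 dP]|[d d0 dP]].
  have [rd d1] : Im d = 0 /\ 0 < Re d by move: d0; rewrite ltcE /= => /andP[/eqP].
  exists (Re d) => // w zw; apply: dP; rewrite /ball /= distrC normcEC.
  by rewrite ltcE /= rd eqxx.
apply/nbhs_ballP; exists d%:C; first by rewrite /= ltcR.
move=> w; rewrite /ball /= distrC normcEC ltcR; exact: dP.
Qed.

Lemma near_realP (t : R) (P : R -> Prop) :
  (\forall s \near t, P s) <->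
  exists2 d : R, 0 < d & forall s, `|s - t| < d -> P s.
Proof.
split=> [/nbhs_ballP[d /= d0 dP]|[d d0 dP]].
  by exists d => // s ts; apply: dP; rewrite /ball /= distrC.
by apply/nbhs_ballP; exists d => // s; rewrite /ball /= distrC; exact: dP.
Qed.

End ComplexNorm.

Section ComplexDerivative.
Context {R : realType}.
Implicit Types (u v g : R -> R[i]) (t s : R) (D : R[i]).

(* The scalars of R[i] as a normed module are complex, so derivatives with
   respect to a real variable are taken on real and imaginary parts. *)
Definition cderive u t D : Prop :=
  is_derive t (1 : R) (fun s => Re (u s)) (Re D) /\
  is_derive t (1 : R) (fun s => Im (u s)) (Im D).

Lemma cderive_epsP u t D : cderive u t D <->
  forall e : R, 0 < e ->
    \forall s \near t, normc (u s - u t - (s - t)%:C * D) <= e * `|s - t|.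
Proof.
have reE s : Re (u s - u t - (s - t)%:C * D) =
    Re (u s) - Re (u t) - (s - t) *: Re D.
  by rewrite !complexReD !complexReN complexReM /= mul0r subr0.
have imE s : Im (u s - u t - (s - t)%:C * D) =
    Im (u s) - Im (u t) - (s - t) *: Im D.
  by rewrite !complexImD !complexImN complexImM /= mul0r addr0.
split=> [[/is_derive1_epsP dr /is_derive1_epsP di] e e0|H].
  have e20 : 0 < e / 2 by rewrite divr_gt0.
  near=> s; apply: le_trans (normc_le _) _; rewrite reE imE (splitr e) mulrDl.
  by apply: lerD; near: s; [exact: dr|exact: di].
split; apply/is_derive1_epsP => e e0; near=> s.
  rewrite -reE; apply: le_trans (Re_le_normc _) _.
  by near: s; exact: H.
rewrite -imE; apply: le_trans (Im_le_normc _) _.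
by near: s; exact: H.
Unshelve. all: by end_near. Qed.

Lemma cderive_near u v t D : (\forall s \near t, u s = v s) ->
  cderive u t D -> cderive v t D.
Proof.
move=> uv [dr di]; split; [apply: near_eq_is_derive dr|apply: near_eq_is_derive di].
  by near=> s; rewrite (near uv s).
by near=> s; rewrite (near uv s).
Unshelve. all: by end_near. Qed.

Lemma cderive_cst D t : cderive (fun=> D) t 0.
Proof. by split; exact: is_derive_cst. Qed.

Lemma cderiveD u v t D D' : cderive u t D -> cderive v t D' ->
  cderive (fun s => u s + v s) t (D + D').
Proof.
move=> [ur ui] [vr vi]; split.
  have := is_deriveD ur vr; rewrite -?complexReD -?complexImD; congr (is_derive _ _ _ _).
  by apply/funext => s; rewrite ?complexReD ?complexImD.
have := is_deriveD ui vi; rewrite -?complexReD -?complexImD; congr (is_derive _ _ _ _).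
by apply/funext => s; rewrite ?complexReD ?complexImD.
Qed.

Lemma cderiveM u v t D D' : cderive u t D -> cderive v t D' ->
  cderive (fun s => u s * v s) t (D * v t + u t * D').
Proof.
move=> [ur ui] [vr vi]; split.
  have -> : (fun s => Re (u s * v s)) =
      (fun s => Re (u s)) * (fun s => Re (v s)) -
      (fun s => Im (u s)) * (fun s => Im (v s)).
    by apply/funext => s; rewrite complexReM.
  apply: is_derive_eq; rewrite complexReD !complexReM /GRing.scale /=; ring.
have -> : (fun s => Im (u s * v s)) =
    (fun s => Re (u s)) * (fun s => Im (v s)) +
    (fun s => Im (u s)) * (fun s => Re (v s)).
  by apply/funext => s; rewrite complexImM.
apply: is_derive_eq; rewrite complexImD !complexImM /GRing.scale /=; ring.
Qed.

Lemma cderiveZ (a : R[i]) u t D : cderive u t D ->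
  cderive (fun s => a * u s) t (a * D).
Proof. by move=> du; have := cderiveM (cderive_cst a t) du; rewrite mul0r add0r. Qed.

Lemma cderive_sum (I : Type) (r : seq I) (P : pred I) (u : I -> R -> R[i]) t
    (D : I -> R[i]) :
  (forall i, P i -> cderive (u i) t (D i)) ->
  cderive (fun s => \sum_(i <- r | P i) u i s) t (\sum_(i <- r | P i) D i).
Proof.
move=> du; elim: r => [|i r IH].
  by under eq_fun do rewrite big_nil; rewrite big_nil; exact: cderive_cst.
under eq_fun do rewrite big_cons; rewrite big_cons.
by case: ifP => // Pi; exact: cderiveD (du _ Pi) IH.
Qed.

Lemma cderiveX u t D n : cderive u t D ->
  cderive (fun s => u s ^+ n) t (n%:R * u t ^+ n.-1 * D).
Proof.
move=> du; elim: n => [|n IH].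
  by under eq_fun do rewrite expr0; rewrite !mul0r; exact: cderive_cst.
under eq_fun do rewrite exprS; have := cderiveM du IH.
congr cderive; rewrite /= -natr1; case: n {IH} => [|n] /=.
  by rewrite !expr0 mulr1 !mul0r mulr0 addr0 add0r !mul1r.
rewrite exprS; ring.
Qed.

Lemma cderive_comp (f : R[i] -> R[i]) g t (D D' : R[i]) :
  is_derive (g t : R[i]^o) (1 : R[i]^o) (f : R[i]^o -> R[i]^o) D ->
  cderive g t D' -> cderive (fun s => f (g s)) t (D * D').
Proof.
move=> /is_derive1_epsP df /cderive_epsP dg; apply/cderive_epsP => e e0.
have N0 := normc_ge0 D; have N0' := normc_ge0 D'.
set N := normc D in N0 *; set N' := normc D' in N0' *.
have N1 : 0 < 1 + N by exact: ltr_pwDl.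
have N1' : 0 < 1 + N' by exact: ltr_pwDl.
(* The error of the composite is the remainder of f at g s plus D times the remainder of g; each
   receives e/2. The summand 1 keeps the divisors positive. *)
have e10 : 0 < e / 2 / (1 + N') by rewrite !divr_gt0.
have e10C : (0 : R[i]) < (e / 2 / (1 + N'))%:C by rewrite ltcR.
(* The minimum with 1 gives |g s - g t| <= (1 + N') |s - t| near t. *)
have e20 : 0 < Num.min 1 (e / 2 / (1 + N)).
  by rewrite lt_min ltr01 !divr_gt0.
have [d1 d10 H1] := (near_complexP _ _).1 (df _ e10C).
have [d2 d20 H2] := (near_realP _ _).1 (dg _ e20).
apply/near_realP; exists (Num.min d2 (d1 / (1 + N'))).
  by rewrite lt_min d20 divr_gt0 ?ltr_wpDr.
move=> s; rewrite lt_min => /andP[/H2 {}H2 sd].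
have G1 : normc (g s - g t) <= (1 + N') * `|s - t|.
  have -> : g s - g t = (g s - g t - (s - t)%:C * D') + (s - t)%:C * D' by ring.
  apply: le_trans (normcD_le _ _) _; rewrite normcM normc_real mulrDl.
  rewrite [N' * _]mulrC; apply: lerD => //; apply: le_trans H2 _.
  by rewrite ler_wpM2r// ge_min lexx.
have G2 : normc (g s - g t) < d1.
  apply: le_lt_trans G1 _; by rewrite mulrC -ltr_pdivlMr.
have := H1 _ G2; rewrite !normcEC -rmorphM lecR /= => {}H1.
have -> : f (g s) - f (g t) - (s - t)%:C * (D * D') =
  (f (g s) - f (g t) - (g s - g t) *: D) +
    D * (g s - g t - (s - t)%:C * D').
  by rewrite /GRing.scale /=; ring.
apply: le_trans (normcD_le _ _) _; rewrite (splitr e) mulrDl normcM.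
apply: lerD.
  apply: le_trans H1 _.
  rewrite -[e / 2 in leRHS](@divfK _ (1 + N')) ?gt_eqF// -[leRHS]mulrA.
  by rewrite ler_wpM2l// ltW.
apply: le_trans (ler_wpM2l N0 H2) _.
rewrite mulrA ler_wpM2r//.
apply: (@le_trans _ _ (N * (e / 2 / (1 + N)))).
  by rewrite ler_wpM2l// ge_min lexx orbT.
have e2 : 0 <= e / 2 by rewrite divr_ge0// ltW.
rewrite mulrCA ler_piMr// ler_pdivrMr//.
by rewrite mul1r lerDr.
Qed.

End ComplexDerivative.

(** * Gronwall's inequality *)

Section Gronwall.
Context {R : realType} {m : nat}.
Implicit Types (v : 'cV[R[i]]_m) (u : R -> 'cV[R[i]]_m).

(** Gronwall's argument differentiates the length of a curve, so the squared euclidean norm replaces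
    the maximum norm that matrices carry. *)
Definition energy v : R := \sum_k normc (v k 0) ^+ 2.

Lemma energy_ge0 v : 0 <= energy v.
Proof. by apply: sumr_ge0 => k _; rewrite sqr_ge0. Qed.

Lemma energy_eq0 v : energy v = 0 -> v = 0.
Proof.
move=> /eqP; rewrite psumr_eq0; last by move=> k _; rewrite sqr_ge0.
move=> /allP v0; apply/colP => k; rewrite mxE; apply: eq0_normc; apply/eqP.
by have := v0 k (mem_index_enum _); rewrite sqrf_eq0.
Qed.

Definition vderive u (t : R) v : Prop :=
  forall k, cderive (fun s => u s k 0) t (v k 0).

(** Cauchy-Schwarz in the plane, by Lagrange's identity. *)
Lemma Re_conj_le (x y : R[i]) : Re x * Re y + Im x * Im y <= normc x * normc y.
Proof.
apply: le_trans (ler_norm _) _.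
rewrite -ler_sqr ?nnegrE ?mulr_ge0 ?normc_ge0// exprMn !normc_sqr.
rewrite real_normK ?num_real// -subr_ge0.
have -> : (Re x ^+ 2 + Im x ^+ 2) * (Re y ^+ 2 + Im y ^+ 2) -
  (Re x * Re y + Im x * Im y) ^+ 2 = (Re x * Im y - Im x * Re y) ^+ 2 by ring.
exact: sqr_ge0.
Qed.

Lemma is_derive_normc_sqr (u : R -> R[i]) t D : cderive u t D ->
  is_derive t (1 : R) (fun s => normc (u s) ^+ 2)
    (2 * (Re (u t) * Re D + Im (u t) * Im D)).
Proof.
move=> [dr di].
have := is_deriveD (is_deriveM dr dr) (is_deriveM di di).
have -> : (fun s => Re (u s)) * (fun s => Re (u s)) +
    (fun s => Im (u s)) * (fun s => Im (u s)) = (fun s => normc (u s) ^+ 2).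
  by apply/funext => s; rewrite normc_sqr !expr2.
by move=> H; apply: is_derive_eq H _; rewrite mulrDr !mulr2n !mulrDl !mul1r.
Qed.

Lemma is_derive_energy u t v : vderive u t v ->
  is_derive t (1 : R) (fun s => energy (u s))
    (\sum_k 2 * (Re (u t k 0) * Re (v k 0) + Im (u t k 0) * Im (v k 0))).
Proof.
move=> du.
have -> : (fun s => energy (u s)) =
    \sum_(k < m) (fun s => normc (u s k 0) ^+ 2).
  by apply/funext => s; rewrite fct_sumE.
exact: (@is_derive_sum _ _ _ m _ t 1
  (fun k => 2 * (Re (u t k 0) * Re (v k 0) + Im (u t k 0) * Im (v k 0)))
  (fun k => is_derive_normc_sqr (du k))).
Qed.

(** Splitting the products in the derivative of the energy E by 2xy <= x^2 + y^2 gives E' <= c E + e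
    with c = 2mK + 1: the double sum over the entries of W contributes 2mK, the defect rho
    contributes 1. *)
Lemma gronwall u (W : R -> 'M[R[i]]_m) (rho : R -> 'cV[R[i]]_m) (K e : R) :
  0 <= K -> 0 <= e ->
  (forall t : R, 0 <= t <= 1 -> vderive u t (W t *m u t + rho t)) ->
  (forall (t : R) i j, 0 <= t <= 1 -> normc (W t i j) <= K) ->
  (forall t : R, 0 <= t <= 1 -> energy (rho t) <= e) ->
  forall t : R, 0 <= t <= 1 ->
    energy (u t) <= expR (2 * m%:R * K + 1) * (energy (u 0) + e).
Proof.
move=> K0 e0 du WK rhoe; set c := 2 * m%:R * K + 1.
have c1 : 1 <= c by rewrite lerDr !mulr_ge0.
pose E' t := \sum_k 2 * (Re (u t k 0) * Re ((W t *m u t + rho t) k 0) +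
  Im (u t k 0) * Im ((W t *m u t + rho t) k 0)).
have E'le (t : R) : 0 <= t <= 1 -> E' t <= c * energy (u t) + e.
  move=> t01; apply: (@le_trans _ _ (\sum_k (\sum_l
      K * (normc (u t k 0) ^+ 2 + normc (u t l 0) ^+ 2) +
      (normc (u t k 0) ^+ 2 + normc (rho t k 0) ^+ 2)))).
    apply: ler_sum => k _; set nk := normc _.
    apply: (@le_trans _ _ (2 * (nk * (\sum_l K * normc (u t l 0) +
        normc (rho t k 0))))).
      rewrite ler_wpM2l//; apply: le_trans (Re_conj_le _ _) _.
      rewrite ler_wpM2l ?normc_ge0// !mxE.
      apply: le_trans (normcD_le _ _) _; rewrite lerD2r.
      elim/big_ind2 : _ => [|x a y b xa yb|l _].
      - by rewrite normc0.
      - by apply: le_trans (normcD_le _ _) _; exact: lerD.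
      - by rewrite normcM ler_wpM2r ?normc_ge0// WK.
    rewrite mulrDr mulrDr !mulr_sumr; apply: lerD.
      apply: ler_sum => l _; set nl := normc _.
      rewrite -subr_ge0.
      have -> : K * (nk ^+ 2 + nl ^+ 2) - 2 * (nk * (K * nl)) =
        K * (nk - nl) ^+ 2 by ring.
      by rewrite mulr_ge0// sqr_ge0.
    rewrite -subr_ge0; set r := normc _.
    have -> : nk ^+ 2 + r ^+ 2 - 2 * (nk * r) = (nk - r) ^+ 2 by ring.
    exact: sqr_ge0.
  rewrite !big_split /= -/(energy (u t)) -/(energy (rho t)).
  under eq_bigr do rewrite -mulr_sumr big_split /= sumr_const card_ord.
  rewrite -mulr_sumr big_split /= sumr_const card_ord sumrMnl.
  rewrite -/(energy (u t)).
  have := rhoe t t01; rewrite /c; clear.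
  move: (energy (u t)) (energy (rho t)) => x r re.
  have -> : K * (x *+ m + x *+ m) = 2 * m%:R * K * x.
    by rewrite -mulr_natl; ring.
  by rewrite addrA [(_ + 1) * x]mulrDl mul1r lerD2l.
(* As c >= 1, also e <= c e, hence E' <= c (E + e) and this product does not increase. *)
pose G (t : R) := (energy (u t) + e) * expR (- c * t).
have dG (t : R) : 0 <= t <= 1 -> is_derive t (1 : R) G
    ((energy (u t) + e) * (expR (- c * t) * - c) + expR (- c * t) * E' t).
  move=> t01.
  have dE : is_derive t (1 : R) (fun s => energy (u s)) (E' t).
    exact/is_derive_energy/du.
  have dX : is_derive t (1 : R) (fun s => expR (- c * s))
      (expR (- c * t) * - c).
    have dl : is_derive t (1 : R) (fun s => - c * s) (- c).
      have -> : (fun s : R => - c * s) = (- c) \*: id by [].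
      by apply: is_derive_eq; rewrite /GRing.scale /= mulr1.
    by have := @is_derive1_comp _ _ _ _ _ _ (is_derive_expR (- c * t)) dl.
  have -> : G = ((fun s => energy (u s)) + cst e) * (fun s => expR (- c * s)).
    by apply/funext.
  by apply: is_derive_eq; rewrite addr0 /GRing.scale.
have Gle (t : R) : 0 <= t <= 1 -> G t <= G 0.
  move=> /andP[t0 t1].
  have in01 (x : R) : x \in `]0, 1[%R -> 0 <= x <= 1.
    by rewrite in_itv /= => /andP[/ltW -> /ltW ->].
  apply: (@ler0_derive1_le_cc _ G 0 1); rewrite ?in_itv /= ?lexx ?t0 ?t1 ?ler01//.
  - by move=> x /in01 /dG[].
  - move=> x /in01 x01; have xd := dG x x01.
    rewrite derive1E derive_val mulrCA -mulrDr pmulr_rle0 ?expR_gt0//.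
    have e1 : e <= c * e by rewrite ler_peMl.
    rewrite mulrN addrC subr_le0 mulrC mulrDr (le_trans (E'le x x01))//.
    by rewrite lerD2l.
  - by apply: derivable_within_continuous => x; rewrite in_itv /= => /dG[].
move=> t t01; have := Gle t t01.
rewrite /G mulr0 expR0 mulr1 => Gt.
apply: (@le_trans _ _ (expR (c * t) * (energy (u 0) + e))).
  have /(ler_wpM2l (expR_ge0 (c * t))) := Gt.
  rewrite mulrCA -expRD mulNr subrr expR0 mulr1 => Gt'.
  by apply: le_trans Gt'; rewrite lerDl.
rewrite ler_wpM2r ?addr_ge0 ?energy_ge0// ler_expR ler_piMr ?(le_trans ler01)//.
by case/andP: t01.
Qed.

End Gronwall.

Lemma coord_mx_norm_le (K : numDomainType) (n p : nat) (M : 'M[K]_(n, p)) i j :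
  `|M i j| <= `|M|.
Proof.
rewrite [leRHS]/Num.norm /= mx_normE -[leLHS]nngE num_le.
exact: (@le_bigmax _ _ _ _ (fun ij => `|M ij.1 ij.2|%:nng) (i, j)).
Qed.

Lemma is_derive1_coord (K : numFieldType) (n p : nat) (f : K^o -> 'M[K]_(n, p))
    (z : K^o) D i j :
  is_derive z (1 : K^o) f D ->
  is_derive z (1 : K^o) (fun w => f w i j : K^o) (D i j).
Proof.
move=> /is_derive1_epsP df; apply/is_derive1_epsP => e e0; near=> w.
have -> : f w i j - f z i j - (w - z) *: D i j =
  (f w - f z - (w - z) *: D) i j by rewrite !mxE.
apply: le_trans (coord_mx_norm_le _ _ _) _.
by near: w; exact: df.
Unshelve. all: by end_near. Qed.

(** * Analytic continuation as a linear differential equation along a path *)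

Section Continuation.
Context {R : realType} {m : nat}.
Implicit Types (A B : 'M[R[i]]_m) (f g : R[i] -> 'cV[R[i]]_m).
Implicit Types (gam dgam : R -> R[i]).

Definition fuchs_coef A B (z : R[i]) : 'M[R[i]]_m :=
  (z - 1)^-1 *: A + z^-1 *: B.

Definition clamp (t : R) := Num.max 0 (Num.min 1 t).

Lemma clamp_id t : 0 <= t <= 1 -> clamp t = t.
Proof. by move=> /andP[t0 t1]; rewrite /clamp min_r// max_r. Qed.

Lemma vderive_branch A B (f : R[i] -> 'cV[R[i]]_m) gam dgam t :
  solves_at A B f (gam t) -> cderive gam t (dgam t) ->
  vderive (fun s => f (gam s)) t
    ((dgam t *: fuchs_coef A B (gam t)) *m f (gam t)).
Proof.
move=> sf dg k; rewrite -scalemxAl mxE mulrC.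
exact: cderive_comp (is_derive1_coord k 0 sf) dg.
Qed.

(* Freezing the family of germs outside [0, 1] makes the value along the path
   differentiable at the endpoints as well. *)
Lemma continuation_ode A B gam dgam f g :
  (forall t : R, 0 <= t <= 1 -> cderive gam t (dgam t)) ->
  continues_along A B gam f g ->
  exists phi : R -> 'cV[R[i]]_m,
    [/\ phi 0 = f (gam 0), phi 1 = g (gam 1) &
      forall t : R, 0 <= t <= 1 ->
        vderive phi t ((dgam t *: fuchs_coef A B (gam t)) *m phi t)].
Proof.
move=> dg [F [Fsol Fcomp F0 F1]].
exists (fun t => F (clamp t) (gam t)); split.
- by rewrite clamp_id ?lexx ?ler01//; exact: nbhs_singleton F0.
- by rewrite clamp_id ?lexx ?ler01//; exact: nbhs_singleton F1.
move=> t t01; have /andP[t0 t1] := t01.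
have FF : \forall s \near t, F t (gam s) = F (clamp s) (gam s).
  (* Times s outside [0, 1] occur arbitrarily near t only if t is an endpoint, and then [clamp s] is
     t itself. *)
  have N0 : \forall s \near t, s < 0 -> t = 0.
    have [->|tn0] := eqVneq t 0; first by apply/near_realP; exists 1.
    apply/near_realP; exists t => [|s]; first by rewrite lt_neqAle eq_sym tn0.
    by rewrite ltr_distl subrr => /andP[/lt_trans s0 _] /s0; rewrite ltxx.
  have N1 : \forall s \near t, 1 < s -> t = 1.
    have [->|tn1] := eqVneq t 1; first by apply/near_realP; exists 1.
    apply/near_realP; exists (1 - t) => [|s]; first by rewrite subr_gt0 lt_neqAle tn1.
    by rewrite ltr_distl subrKC => /andP[_ /lt_trans s1] /s1; rewrite ltxx.
  near=> s; rewrite /clamp.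
  have [s0|s0] := ltP s 0.
    rewrite min_r ?(le_trans (ltW s0))// max_l ?(ltW s0)//.
    by congr F; apply: (near N0 s).
  have [s1|s1] := ltP 1 s.
    rewrite max_r//.
    by congr F; apply: (near N1 s).
  rewrite max_r//; apply/esym.
  have s01 : 0 <= s <= 1 by rewrite s0.
  exact: (nbhs_singleton (near (Fcomp t t01) s _ s01)).
have := vderive_branch (nbhs_singleton (Fsol t t01)) (dg t t01).
by rewrite clamp_id// => dF k; apply: cderive_near (dF k); near=> s; rewrite (near FF s).
Unshelve. all: by end_near. Qed.

End Continuation.

Section VectorDerivative.
Context {R : realType} {m : nat}.
Implicit Types (u v : R -> 'cV[R[i]]_m) (t : R).

Lemma vderiveD u v t D D' : vderive u t D -> vderive v t D' ->
  vderive (fun s => u s + v s) t (D + D').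
Proof.
move=> du dv k; rewrite mxE; under eq_fun do rewrite mxE.
exact: cderiveD (du k) (dv k).
Qed.

Lemma vderiveZ (a : R[i]) u t D : vderive u t D ->
  vderive (fun s => a *: u s) t (a *: D).
Proof.
move=> du k; rewrite mxE; under eq_fun do rewrite mxE.
exact: cderiveZ (du k).
Qed.

Lemma energyN (v : 'cV[R[i]]_m) : energy (- v) = energy v.
Proof. by apply: eq_bigr => k _; rewrite mxE normc_opp. Qed.

Lemma energy0 : energy (0 : 'cV[R[i]]_m) = 0.
Proof. by apply: big1 => k _; rewrite mxE normc0 expr0n. Qed.

End VectorDerivative.

Section Stability.
Context {R : realType} {m : nat} (A B : 'M[R[i]]_m).
Implicit Types (f g : R[i] -> 'cV[R[i]]_m) (gam dgam : R -> R[i]).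

(** The explicit bounds on the speed and on the distance to 0 and 1 control the system pulled back
    to [0, 1] without a compactness argument. *)
Definition regular_path gam dgam : Prop :=
  (forall t : R, 0 <= t <= 1 -> cderive gam t (dgam t)) /\
  exists G d : R, 0 < d /\ forall t : R, 0 <= t <= 1 ->
    [/\ normc (dgam t) <= G, d <= normc (gam t) & d <= normc (gam t - 1)].

Lemma regular_path_bound gam dgam : regular_path gam dgam ->
  exists2 K : R, 0 <= K & forall (t : R) i j, 0 <= t <= 1 ->
    normc ((dgam t *: fuchs_coef A B (gam t)) i j) <= K.
Proof.
move=> [_ [G [d [d0 Gd]]]].
have G0 : 0 <= G.
  have [|G0 _ _] := Gd 0; first by rewrite lexx ler01.
  exact: le_trans (normc_ge0 _) G0.
pose N := \sum_i \sum_j (normc (A i j) + normc (B i j)).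
have Nle i j : normc (A i j) + normc (B i j) <= N.
  rewrite /N (bigD1 i)//= (bigD1 j)//= -addrA lerDl addr_ge0//.
    by apply: sumr_ge0 => k _; rewrite addr_ge0 ?normc_ge0.
  by apply: sumr_ge0 => k _; apply: sumr_ge0 => l _; rewrite addr_ge0 ?normc_ge0.
have N0 : 0 <= N.
  by apply: sumr_ge0 => k _; apply: sumr_ge0 => l _; rewrite addr_ge0 ?normc_ge0.
exists (G * (d^-1 * N)) => [|t i j t01].
  by rewrite !mulr_ge0// invr_ge0 ltW.
have [Gt gt0 gt1] := Gd t t01.
have V (x : R[i]) : d <= normc x -> normc x^-1 <= d^-1.
  by move=> dx; rewrite normcV lef_pV2 ?posrE ?(lt_le_trans d0).
rewrite !mxE normcM; apply: ler_pM; rewrite ?normc_ge0//.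
apply: le_trans (normcD_le _ _) _; rewrite !normcM.
apply: (@le_trans _ _ (d^-1 * (normc (A i j) + normc (B i j)))).
  by rewrite mulrDr; apply: lerD; rewrite ler_wpM2r ?normc_ge0// V.
by rewrite ler_wpM2l// invr_ge0 ltW.
Qed.

(** The difference between a continuation and an approximate solution psi satisfies the system with
    defect -rho, so Gronwall's inequality applies. C is chosen before f, g and psi, which allows
    sequences of approximate solutions; v is the value of the continuation at time t, tied to f and
    g at the two ends. *)
Lemma continuation_stable gam dgam : regular_path gam dgam ->
  exists2 C : R, 0 <= C & forall f g, continues_along A B gam f g ->
    forall (psi rho : R -> 'cV[R[i]]_m) (e : R), 0 <= e ->
    (forall t : R, 0 <= t <= 1 -> vderive psi t
       ((dgam t *: fuchs_coef A B (gam t)) *m psi t + rho t)) ->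
    (forall t : R, 0 <= t <= 1 -> energy (rho t) <= e) ->
    forall t : R, 0 <= t <= 1 -> exists2 v : 'cV[R[i]]_m,
      (t = 0 -> v = f (gam 0)) /\ (t = 1 -> v = g (gam 1)) &
      energy (v - psi t) <= C * (energy (f (gam 0) - psi 0) + e).
Proof.
move=> reg; have [K K0 KW] := regular_path_bound reg.
exists (expR (2 * m%:R * K + 1)); first exact: expR_ge0.
move=> f g /(continuation_ode reg.1)[phi [phi0 phi1 dphi]] psi rho e e0 dpsi re t t01.
exists (phi t); first by split=> ->.
rewrite -phi0.
apply: (@gronwall _ _ (fun t => phi t - psi t) _ (fun t => - rho t) K e K0 e0
  _ KW) => // s s01; last by rewrite energyN re.
have := vderiveD (dphi s s01) (vderiveZ (-1) (dpsi s s01)).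
rewrite scaleN1r mulmxBr opprD addrA.
by congr vderive; apply/funext => x; rewrite scaleN1r.
Qed.

(** A combination of two continuations is an approximate solution with defect 0. Since only values
    at the ends are related, this yields both uniqueness (a = 0) and linearity of the monodromy. *)
Lemma continuation_linear gam dgam f g f1 g1 f2 g2 (a : R[i]) :
  regular_path gam dgam ->
  continues_along A B gam f g -> continues_along A B gam f1 g1 ->
  continues_along A B gam f2 g2 ->
  f (gam 0) = a *: f1 (gam 0) + f2 (gam 0) ->
  g (gam 1) = a *: g1 (gam 1) + g2 (gam 1).
Proof.
move=> reg fg /(continuation_ode reg.1)[u [u0 u1 du]].
move=> /(continuation_ode reg.1)[v [v0 v1 dv]] f0.
have [C C0 stab] := continuation_stable reg.
have [|||w [_ w1]] := stab _ _ fg (fun t => a *: u t + v t) (fun=> 0) 0 (lexx _) _ _ 1.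
- move=> t t01; rewrite addr0 mulmxDr -scalemxAr.
  exact: vderiveD (vderiveZ a (du t t01)) (dv t t01).
- by move=> t t01; rewrite energy0.
- by rewrite lexx ler01.
rewrite u0 v0 -f0 subrr energy0 addr0 mulr0 => we.
have /energy_eq0/eqP : energy (w - (a *: u 1 + v 1)) = 0.
  by apply/eqP; rewrite eq_le we energy_ge0.
by rewrite subr_eq0 w1// u1 v1 => /eqP.
Qed.

Lemma continuation_unique gam dgam f g f' g' : regular_path gam dgam ->
  continues_along A B gam f g -> continues_along A B gam f' g' ->
  f (gam 0) = f' (gam 0) -> g (gam 1) = g' (gam 1).
Proof.
move=> reg fg fg' f0.
have H : f (gam 0) = 0 *: f (gam 0) + f' (gam 0) by rewrite scale0r add0r.
by rewrite (continuation_linear reg fg fg fg' H) scale0r add0r.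
Qed.

End Stability.

(** * Loops and monodromy operators *)

Section Subpaths.
Context {R : realType} {m : nat} (A B : 'M[R[i]]_m).
Implicit Types (f g : R[i] -> 'cV[R[i]]_m) (gam dgam : R -> R[i]).

(** Affine changes of time cover reversal (a = 1, b = -1) and both halves of a path (b = 1/2) at
    once. *)
Lemma continues_along_subpath gam f g (F : R -> R[i] -> 'cV[R[i]]_m) (a b : R) :
  (forall t : R, 0 <= t <= 1 ->
     \forall w \near (gam t : R[i]^o), solves_at A B (F t) w) ->
  (forall t : R, 0 <= t <= 1 -> \forall s \near t, 0 <= s <= 1 ->
     \forall w \near (gam s : R[i]^o), F s w = F t w) ->
  (forall t : R, 0 <= t <= 1 -> 0 <= a + b * t <= 1) ->
  (\forall w \near (gam a : R[i]^o), F a w = f w) ->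
  (\forall w \near (gam (a + b) : R[i]^o), F (a + b) w = g w) ->
  continues_along A B (fun t => gam (a + b * t)) f g.
Proof.
move=> Fsol Fcomp ab Ff Fg; exists (fun t => F (a + b * t)); split.
- by move=> t /ab; exact: Fsol.
- move=> t /ab t01; have /near_realP[d d0 dP] := Fcomp _ t01.
  have b0 : 0 < 1 + `|b| by exact: ltr_pwDl.
  apply/near_realP; exists (d / (1 + `|b|)); first by rewrite divr_gt0.
  move=> s sd /ab; apply: dP; rewrite opprD addrACA subrr add0r -mulrBr normrM.
  apply: le_lt_trans (_ : (1 + `|b|) * `|s - t| < d).
    by rewrite ler_wpM2r// lerDr.
  by rewrite mulrC -ltr_pdivlMr.
- by rewrite mulr0 addr0.
- by rewrite mulr1.
Qed.

Lemma continues_along_reverse gam f g : continues_along A B gam f g ->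
  continues_along A B (fun t => gam (1 + (-1) * t)) g f.
Proof.
move=> [F [Fsol Fcomp F0 F1]]; apply: (continues_along_subpath Fsol Fcomp).
- by move=> t /andP[t0 t1]; rewrite mulN1r subr_ge0 t1 gerBl.
- exact: F1.
- have -> : 1 + -1 = 0 :> R by exact: subrr.
  exact: F0.
Qed.

Lemma continues_along_halves gam f g : continues_along A B gam f g ->
  exists h, continues_along A B (fun t => gam (0 + 2^-1 * t)) f h /\
    continues_along A B (fun t => gam (2^-1 + 2^-1 * t)) h g.
Proof.
have half1 : (2^-1 : R) + 2^-1 = 1 by rewrite [RHS]splitr mul1r.
move=> [F [Fsol Fcomp F0 F1]]; exists (F 2^-1); split.
  apply: (@continues_along_subpath gam f (F 2^-1) F 0 2^-1 Fsol Fcomp).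
  - move=> t /andP[t0 t1]; rewrite add0r mulr_ge0//= mulrC.
    by rewrite ler_pdivrMr// mul1r (le_trans t1)// ler1n.
  - exact: F0.
  - by rewrite add0r; apply/near_complexP; exists 1.
apply: (@continues_along_subpath gam (F 2^-1) g F 2^-1 2^-1 Fsol Fcomp).
- move=> t /andP[t0 t1]; rewrite addr_ge0 ?mulr_ge0//= -[leRHS]half1 lerD2l.
  by rewrite ler_piMr.
- by apply/near_complexP; exists 1.
- by rewrite half1; exact: F1.
Qed.

Lemma eq_continues_along gam gam' f g :
  (forall t : R, 0 <= t <= 1 -> gam t = gam' t) ->
  continues_along A B gam f g -> continues_along A B gam' f g.
Proof.
move=> gg [F [Fsol Fcomp F0 F1]]; exists F.
have I0 : 0 <= (0 : R) <= 1 by rewrite lexx ler01.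
have I1 : 0 <= (1 : R) <= 1 by rewrite lexx ler01.
split.
- by move=> t t01; rewrite -(gg t t01); exact: Fsol.
- move=> t t01; have := Fcomp t t01; apply: filterS => s + s01.
  by rewrite -(gg s s01) => /(_ s01).
- by rewrite -(gg 0 I0).
- by rewrite -(gg 1 I1).
Qed.

End Subpaths.

Section BasicPaths.
Context {R : realType}.

Lemma base_pointE : base_point = (2^-1 : R)%:C.
Proof. by rewrite /base_point fmorphV rmorphD rmorph1. Qed.

Lemma normc_expi (x : R) : normc (expi x) = 1.
Proof. by rewrite /= cos2Dsin2 sqrtr1. Qed.

Lemma expiD (x y : R) : expi (x + y) = expi x * expi y.
Proof. by apply/eqP; rewrite eq_complex /= cosD sinD eqxx addrC /=. Qed.

Lemma expi0 : expi (0 : R) = 1.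
Proof. by rewrite /expi cos0 sin0. Qed.

Lemma expi2pi : expi (2 * pi : R) = 1.
Proof. by rewrite /expi mulr_natl cos2pi sin2pi. Qed.

Lemma cderive_expi (a t : R) :
  cderive (fun s => expi (a * s)) t (0 +i* a * expi (a * t)).
Proof.
have dl : is_derive t (1 : R) (fun s => a * s) a.
  have := is_deriveZ a (is_derive_id t (1 : R)).
  by rewrite [a *: 1]mulr1.
split.
  rewrite complexReM /= mul0r sub0r -mulrN mulrC.
  exact: (is_derive1_comp (is_derive_cos (a * t)) dl).
rewrite complexImM /= mul0r add0r mulrC.
exact: (is_derive1_comp (is_derive_sin (a * t)) dl).
Qed.

Definition dloop0 (t : R) : R[i] :=
  2^-1 * (0 +i* (2 * pi) * expi (2 * pi * t)).

Lemma normc_half : normc (2^-1 : R[i]) = 2^-1.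
Proof. by rewrite -[2^-1]/base_point base_pointE normc_real ger0_norm. Qed.

Lemma normc_subr_ge (x y : R[i]) : normc x - normc y <= normc (x - y).
Proof. by rewrite lerBlDr -[x in normc x](subrK y) normcD_le. Qed.

Lemma normc_loop0 (t : R) : normc (loop0 t) = 2^-1.
Proof. by rewrite normcM normc_half normc_expi mulr1. Qed.

Lemma loop0_sub1 (t : R) : 2^-1 <= normc (loop0 t - 1).
Proof.
rewrite -normc_opp opprB.
have := normc_subr_ge 1 (loop0 t).
rewrite normc1 normc_loop0; apply: le_trans.
by rewrite lerBrDr [leRHS]splitr mul1r.
Qed.

Lemma normc_dloop0 (t : R) : normc (dloop0 t) = pi.
Proof.
rewrite !normcM normc_half normc_expi mulr1 /= expr0n add0r sqrtr_sqr.
by rewrite ger0_norm ?mulr_ge0 ?pi_ge0// mulKf.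
Qed.

Lemma regular_loop0 : regular_path (@loop0 R) dloop0.
Proof.
split=> [t _|]; first exact/cderiveZ/cderive_expi.
exists pi, 2^-1; split=> [|t _]; first by rewrite invr_gt0.
by rewrite normc_dloop0 normc_loop0 loop0_sub1 !lexx.
Qed.

(** [loop1] is 1 minus [loop0], so the distances to 0 and 1 are exchanged. *)
Lemma regular_loop1 : regular_path (@loop1 R) (fun t => - dloop0 t).
Proof.
split=> [t t01|].
  have := cderiveD (cderive_cst 1 t) (cderiveZ (-1) (regular_loop0.1 t t01)).
  congr cderive; last by rewrite add0r; exact: mulN1r.
  by apply/funext => s; congr (1 + _); exact: mulN1r.
have E (t : R) : loop1 t = 1 - loop0 t by [].
exists pi, 2^-1; split=> [|t _]; first by rewrite invr_gt0.
rewrite normc_opp normc_dloop0 E -normc_opp opprB loop0_sub1 lexx.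
by rewrite addrAC subrr add0r normc_opp normc_loop0.
Qed.

Lemma loop0_0 : loop0 (0 : R) = base_point.
Proof. by rewrite /loop0 mulr0 expi0 mulr1. Qed.

Lemma loop0_1 : loop0 (1 : R) = base_point.
Proof. by rewrite /loop0 mulr1 expi2pi mulr1. Qed.

Lemma one_sub_half : 1 - 2^-1 = 2^-1 :> R[i].
Proof. by apply/eqP; rewrite subr_eq [eqbLHS]splitr mul1r. Qed.

Lemma loop1_0 : loop1 (0 : R) = base_point.
Proof. by rewrite /loop1 mulr0 expi0 mulr1 one_sub_half. Qed.

Lemma loop1_1 : loop1 (1 : R) = base_point.
Proof. by rewrite /loop1 mulr1 expi2pi mulr1 one_sub_half. Qed.

End BasicPaths.

Section Monodromy.
Context {R : realType} {m : nat} {A B : 'M[R[i]]_m}.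
Local Notation sol := (solution A B).
Implicit Types (f g : sol) (M : sol -> sol).

Definition base_value f : 'cV[R[i]]_m := f base_point.

Lemma base_value_linear : linear base_value.
Proof. by []. Qed.

Lemma solution_branch f : is_branch A B f.
Proof. exact/asboolP/(valP f). Qed.

Lemma base_discE (z : R[i]) : base_disc z = (normc (z - base_point) < 2^-1) :> Prop.
Proof. by rewrite /base_disc /= normcEC -/base_point base_pointE ltcR. Qed.

Lemma near_base_disc (z : R[i]) : base_disc z ->
  \forall w \near (z : R[i]^o), base_disc w.
Proof.
rewrite base_discE => zd; apply/near_complexP.
exists (2^-1 - normc (z - base_point)); first by rewrite subr_gt0.
move=> w wz; rewrite base_discE -(subrKA z).
by apply: le_lt_trans (normcD_le _ _) _; rewrite -ltrBrDr.
Qed.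

(** Both singular points lie at distance 1/2 from the base point, so the segment stays at distance
    at least 1/2 - r from them. *)
Lemma regular_segment (z : R[i]) : base_disc z ->
  regular_path (fun t : R => base_point + t%:C * (z - base_point))
    (fun=> z - base_point).
Proof.
rewrite base_discE; set r := normc _ => zd.
split=> [t _|].
  have dt : cderive (fun t : R => t%:C) t 1.
    by split; [exact: is_derive_id|exact: is_derive_cst].
  have := cderiveD (cderive_cst base_point t)
    (cderiveM dt (cderive_cst (z - base_point) t)).
  by rewrite mul1r mulr0 addr0 add0r.
exists r, (2^-1 - r); split=> [|t /andP[t0 t1]]; first by rewrite subr_gt0.
have rt : normc (t%:C * (z - base_point)) <= r.
  by rewrite normcM normc_real ger0_norm// ler_piMl ?normc_ge0.
split=> //.
  rewrite -[t%:C * _]opprK; apply: le_trans (normc_subr_ge _ _).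
  by rewrite normc_half normc_opp lerD2l lerN2.
have -> : base_point + t%:C * (z - base_point) - 1 =
  t%:C * (z - base_point) - base_point.
  have H (x b : R[i]) : b + b = 1 -> b + x - 1 = x - b by move=> <-; ring.
  by apply: H; rewrite [RHS]splitr mul1r.
rewrite -normc_opp opprB; apply: le_trans (normc_subr_ge _ _).
by rewrite normc_half lerD2l lerN2.
Qed.

Lemma continues_along_segment f (z : R[i]) : base_disc z ->
  continues_along A B (fun t : R => base_point + t%:C * (z - base_point)) f f.
Proof.
move=> zd; exists (fun=> f); split.
- move=> t t01; have [sf _] := solution_branch f.
  have : base_disc (base_point + t%:C * (z - base_point)).
    move: zd; rewrite !base_discE; apply: le_lt_trans.
    rewrite addrAC subrr add0r normcM normc_real.
    by have /andP[t0 t1] := t01; rewrite ger0_norm// ler_piMl ?normc_ge0.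
  by move=> /near_base_disc; apply: filterS => w; exact: sf.
- by move=> t _; apply/near_realP; exists 1 => // s _ _; apply/near_complexP; exists 1.
- by apply/near_complexP; exists 1.
- by apply/near_complexP; exists 1.
Qed.

(** Inside the disc, uniqueness of continuation along the segment from the base point to z applies;
    outside, all branches are 0. *)
Lemma base_value_inj : injective base_value.
Proof.
move=> f g fg; apply/val_inj/funext => z /=.
have [zd|zd] := pselect (base_disc z); last first.
  by rewrite (solution_branch f).2// (solution_branch g).2.
have := continuation_unique (regular_segment zd) (continues_along_segment f zd)
  (continues_along_segment g zd).
by rewrite mul0r addr0 mul1r subrKC; exact.
Qed.

Lemma monodromy_linear gam dgam M : regular_path gam dgam ->
  gam 0 = base_point -> gam 1 = base_point ->
  monodromy_operator gam M -> linear M.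
Proof.
move=> reg g0 g1 HM a f g; apply: base_value_inj.
rewrite base_value_linear /base_value -g1.
by apply: (continuation_linear reg (HM _) (HM _) (HM _)); rewrite g0.
Qed.

(** The continuation along [loopoo] is cut at its midpoint and both halves are run backwards: from
    Moo f around 0 to a germ h, then from h around 1 to f. The germ h need not be a branch on the
    whole disc, so it is compared with M0 (Moo f) at the base point only. *)
Lemma monodromy_infinity (M0 M1 Moo : sol -> sol) :
  monodromy_operator loop0 M0 -> monodromy_operator loop1 M1 ->
  monodromy_operator loopoo Moo -> forall f, M1 (M0 (Moo f)) = f.
Proof.
move=> H0 H1 Hoo f; apply: base_value_inj.
have rev1 (t : R) : 1 + (-1) * (1 + (-1) * t) = t by ring.
have [h [h1 h0]] := continues_along_halves (Hoo f).
have {}h1 : continues_along A B loop1 h f.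
  have : continues_along A B (fun t => loop1 (1 + (-1) * t)) f h.
    apply: eq_continues_along h1 => t /andP[t0 t1].
    rewrite /loopoo add0r ifT; last by rewrite ler_piMr.
    by rewrite mulVKf// mulN1r.
  move=> /continues_along_reverse; apply: eq_continues_along => t _.
  by rewrite rev1.
have {}h0 : continues_along A B loop0 (Moo f) h.
  have : continues_along A B (fun t => loop0 (1 + (-1) * t)) h (Moo f).
    apply: eq_continues_along h0 => t /andP[t0 t1].
    rewrite /loopoo; case: ifPn => ht.
      (* The midpoint still belongs to the first case of [loopoo]; both loops are at the base point
         there. *)
      have -> : t = 0.
        apply/eqP; rewrite eq_le t0 andbT.
        by move: ht; rewrite gerDl pmulr_rle0// invr_gt0.
      by rewrite !mulr0 !addr0 divff// subrr loop1_0 loop0_1.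
    congr loop0; rewrite mulrDr mulVKf// divff// mulN1r opprD addrA.
    by congr (_ - _); apply/eqP; rewrite subr_eq.
  move=> /continues_along_reverse; apply: eq_continues_along => t _.
  by rewrite rev1.
have E0 := continuation_unique regular_loop0 h0 (H0 (Moo f)) erefl.
have := continuation_unique regular_loop1 h1 (H1 (M0 (Moo f))).
by move: E0; rewrite !(loop0_0, loop0_1, loop1_0, loop1_1) => E0 /(_ E0)/esym.
Qed.

HB.instance Definition _ := GRing.isLinear.Build R[i] sol 'cV[R[i]]_m *:%R
  base_value base_value_linear.

End Monodromy.

(** * Local solutions at 1 *)

Section MatrixNorm.
Context {R : realType}.

(** This norm is submultiplicative, unlike the maximum norm of matrices, and takes its values in
    [R]. *)
Definition mxl1 n p (M : 'M[R[i]]_(n, p)) : R := \sum_i \sum_j normc (M i j).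

Lemma mxl1_ge0 n p (M : 'M[R[i]]_(n, p)) : 0 <= mxl1 M.
Proof. by apply: sumr_ge0 => i _; apply: sumr_ge0 => j _; exact: normc_ge0. Qed.

Lemma normc_le_mxl1 n p (M : 'M[R[i]]_(n, p)) i j : normc (M i j) <= mxl1 M.
Proof.
rewrite /mxl1 (bigD1 i)//= (bigD1 j)//= -addrA lerDl addr_ge0//.
  by apply: sumr_ge0 => k _; exact: normc_ge0.
by apply: sumr_ge0 => k _; apply: sumr_ge0 => l _; exact: normc_ge0.
Qed.

Lemma mxl1D n p (M N : 'M[R[i]]_(n, p)) : mxl1 (M + N) <= mxl1 M + mxl1 N.
Proof.
rewrite -big_split ler_sum// => i _; rewrite -big_split ler_sum// => j _.
by rewrite mxE normcD_le.
Qed.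

Lemma mxl1Z n p (a : R[i]) (M : 'M[R[i]]_(n, p)) :
  mxl1 (a *: M) = normc a * mxl1 M.
Proof.
rewrite /mxl1 mulr_sumr; apply: eq_bigr => i _; rewrite mulr_sumr.
by apply: eq_bigr => j _; rewrite mxE normcM.
Qed.

Lemma mxl1N n p (M : 'M[R[i]]_(n, p)) : mxl1 (- M) = mxl1 M.
Proof.
apply: eq_bigr => i _; apply: eq_bigr => j _.
by rewrite mxE normc_opp.
Qed.

Lemma normc_sum_le (I : Type) (r : seq I) (P : pred I) (F : I -> R[i]) :
  normc (\sum_(i <- r | P i) F i) <= \sum_(i <- r | P i) normc (F i).
Proof.
elim/big_ind2 : _ => [|x a y b xa yb|//]; first by rewrite normc0.
by apply: le_trans (normcD_le _ _) _; exact: lerD.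
Qed.

Lemma mxl1M n p q (M : 'M[R[i]]_(n, p)) (N : 'M[R[i]]_(p, q)) :
  mxl1 (M *m N) <= mxl1 M * mxl1 N.
Proof.
rewrite /mxl1 mulr_suml ler_sum// => i _; rewrite mulr_suml.
apply: (@le_trans _ _ (\sum_k \sum_j normc (M i j) * normc (N j k))).
  rewrite ler_sum// => k _; rewrite mxE; apply: le_trans (normc_sum_le _ _ _) _.
  by rewrite ler_sum// => j _; rewrite normcM.
rewrite exchange_big ler_sum// => j _; rewrite -mulr_sumr ler_wpM2l ?normc_ge0//.
rewrite [leRHS](bigD1 j)//= lerDl.
by apply: sumr_ge0 => k _; apply: sumr_ge0 => l _; exact: normc_ge0.
Qed.

Lemma energy_le_mxl1 n (v : 'cV[R[i]]_n) : energy v <= mxl1 v ^+ 2.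
Proof.
have E : mxl1 v = \sum_i normc (v i 0).
  by apply: eq_bigr => i _; rewrite big_ord_recl big_ord0 addr0.
rewrite expr2 [X in X * _]E mulr_suml ler_sum// => i _.
by rewrite expr2 ler_wpM2l ?normc_ge0// normc_le_mxl1.
Qed.

End MatrixNorm.

Section GeometricBounds.
Context {R : realType}.

Lemma real_series_limit (u : nat -> R) (K q : R) : 0 <= q < 1 ->
  (forall n, `|u n| <= K * q ^+ n) ->
  exists l : R, (fun N : nat => `|l - \sum_(n < N) u n|) @ \oo --> (0 : R).
Proof.
move=> /andP[q0 q1] uK.
have : cvgn (series u).
  apply: normed_cvg.
  apply: (@series_le_cvg _ _ (geometric K q)) => [n|n|n|] //=.
  - exact: le_trans (uK n).
  - by apply: is_cvg_geometric_series; rewrite ger0_norm.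
move=> /cvg_ex[l ul]; exists l.
have E : (fun N : nat => `|l - \sum_(n < N) u n|) =
    (fun N => `|(cst l - series u) N|).
  by apply/funext => N; congr `|_ - _|; rewrite /series /= big_mkord.
have := cvg_norm (cvgB (cvg_cst l) ul).
by rewrite E subrr normr0; apply.
Qed.

Lemma complex_series_limit (u : nat -> R[i]) (K q : R) : 0 <= q < 1 ->
  (forall n, normc (u n) <= K * q ^+ n) ->
  exists l, (fun N : nat => normc (l - \sum_(n < N) u n)) @ \oo --> (0 : R).
Proof.
move=> q01 uK.
have [|x ux] := @real_series_limit (fun n => Re (u n)) K q q01.
  by move=> n; exact: le_trans (Re_le_normc _) (uK n).
have [|y uy] := @real_series_limit (fun n => Im (u n)) K q q01.
  by move=> n; exact: le_trans (Im_le_normc _) (uK n).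
have ReS N : Re (\sum_(n < N) u n) = \sum_(n < N) Re (u n).
  by elim/big_rec2 : _ => //= i a b _ <-; rewrite complexReD.
have ImS N : Im (\sum_(n < N) u n) = \sum_(n < N) Im (u n).
  by elim/big_rec2 : _ => //= i a b _ <-; rewrite complexImD.
exists (x +i* y).
apply: (@squeeze_cvgr _ _ _ _ (cst 0) (fun N => `|x - \sum_(n < N) Re (u n)| +
  `|y - \sum_(n < N) Im (u n)|)).
- near=> N; rewrite normc_ge0 /=; apply: le_trans (normc_le _) _.
  by rewrite complexReD complexImD complexReN complexImN ReS ImS.
- exact: cvg_cst.
- by have := cvgD ux uy; rewrite addr0; apply.
Unshelve. all: by end_near. Qed.

End GeometricBounds.

(** X acts by 0 and d only, so its resolvent is a polynomial of degree 1 in X: its values there are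
    1/x and 1/(x - d). *)
Lemma quadratic_resolvent (F : fieldType) (n : nat) (X : 'M[F]_n) (x d : F) :
  X *m X = d *: X -> x != 0 -> x - d != 0 ->
  (x^-1 *: (1%:M + (x - d)^-1 *: X)) *m (x%:M - X) = 1%:M.
Proof.
move=> XX x0 xd; rewrite -scalemxAl mulmxDl mul1mx -scalemxAl mulmxBr XX.
rewrite mul_mx_scalar -scalerBl scalerA mulVf// scale1r subrK.
by rewrite scale_scalar_mx mulVf.
Qed.

Section Frobenius.
Context {R : realType} {m : nat} (A B : 'M[R[i]]_m) (a1 a2 : R).
Hypothesis A_split : (A - a2%:C%:M) *m (A - a1%:C%:M) = 0.
Hypothesis a12_nint : a1 - a2 \isn't a Num.int.

Local Notation A' := (A - a2%:C%:M).
Local Notation d := (a1 - a2).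

Lemma shift_sqr : A' *m A' = d%:C *: A'.
Proof.
apply/eqP; rewrite -subr_eq0; apply/eqP; rewrite -A_split.
have -> : A - a1%:C%:M = A' - d%:C%:M.
  by rewrite rmorphB /= raddfB /= opprB addrA subrK.
by rewrite [RHS]mulmxBr mul_mx_scalar.
Qed.

(** The inverse of n - A', written out so that its size O(1/n) can be read off. *)
Definition frob_inv (n : nat) : 'M[R[i]]_m :=
  n%:R^-1 *: (1%:M + (n%:R - d%:C)^-1 *: A').

(** The non-resonance condition of the Frobenius method. *)
Lemma nat_sub_neq0 n : n%:R - d%:C != 0 :> R[i].
Proof.
apply/eqP => /eqP; rewrite subr_eq0 -(rmorph_nat (real_complex R)).
move=> /eqP/complexI nd; move: a12_nint; rewrite -nd.
by rewrite natr_int.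
Qed.

Lemma frob_invK n : (0 < n)%N -> frob_inv n *m (n%:R%:M - A') = 1%:M.
Proof.
move=> n0; have nn0 : n%:R != 0 :> R[i] by rewrite pnatr_eq0 -lt0n.
exact: quadratic_resolvent shift_sqr nn0 (nat_sub_neq0 n).
Qed.

Lemma frob_invVK n : (0 < n)%N -> (n%:R%:M - A') *m frob_inv n = 1%:M.
Proof. by move=> n0; apply: mulmx1C; exact: frob_invK. Qed.

(* Coefficients of the solutions (z-1)^a2 sum_n V_n (z-1)^n: multiplying the
   system by z (z-1) gives the recursion [frobE], and V_0 = A - a1 starts it
   because its image is the a2-eigenspace of A. *)
Fixpoint frob (n : nat) : 'M[R[i]]_m :=
  if n is n'.+1 then frob_inv n *m ((A' + B - n'%:R%:M) *m frob n')
  else A - a1%:C%:M.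

Lemma frobE n :
  (n.+1%:R%:M - A') *m frob n.+1 = (A' + B - n%:R%:M) *m frob n.
Proof. by rewrite /= mulmxA frob_invVK// mul1mx. Qed.

(** From A' + B - n = (1 + B) - (n + 1 - A'). The leading term -V_n shows that the coefficients grow
    by a factor 1 + O(1/n) only. *)
Lemma frobS n :
  frob n.+1 = - frob n + frob_inv n.+1 *m ((1%:M + B) *m frob n).
Proof.
have -> : - frob n = (- 1%:M) *m frob n by rewrite mulNmx mul1mx.
rewrite /= !mulmxA -mulmxDl; congr (_ *m _).
rewrite -[in - 1%:M](frob_invK (ltn0Sn n)) -mulmxN -mulmxDr; congr (_ *m _).
move: (A - _) => X; apply/matrixP => i j; rewrite !mxE.
by case: eqP => _; rewrite ?(mulr1n, mulr0n) -?natr1; ring.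
Qed.

End Frobenius.

Section FrobeniusBounds.
Context {R : realType} {m : nat} (A B : 'M[R[i]]_m) (a1 a2 : R).
Hypothesis A_split : (A - a2%:C%:M) *m (A - a1%:C%:M) = 0.
Hypothesis a12_nint : a1 - a2 \isn't a Num.int.

Local Notation A' := (A - a2%:C%:M).
Local Notation d := (a1 - a2).
Local Notation frob := (frob A B a1 a2).
Local Notation frob_inv := (frob_inv A a1 a2).

Lemma frob_inv_bound (n : nat) : (0 < n)%N -> `|d| + 1 <= n%:R ->
  mxl1 (frob_inv n) <= (mxl1 (1%:M : 'M[R[i]]_m) + mxl1 A') / n%:R.
Proof.
move=> n0 dn; have nC (k : nat) : k%:R = (k%:R : R)%:C by rewrite rmorph_nat.
rewrite mxl1Z normcV nC normc_real ger0_norm// mulrC ler_wpM2r ?invr_ge0//.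
apply: le_trans (mxl1D _ _) _; rewrite lerD2l mxl1Z ler_piMl ?mxl1_ge0//.
rewrite -rmorphB normcV normc_real invf_le1.
  apply: le_trans (ler_norm _).
  by rewrite lerBrDr addrC (le_trans _ dn)// lerD2r ler_norm.
apply: lt_le_trans (ler_norm _); rewrite subr_gt0.
by apply: lt_le_trans dn; rewrite ltr_pwDr// ler_norm.
Qed.

(** Any rate above 1 could be reached; 5/4 is small enough that its square, halved by the radius of
    the loop, stays below 1. From index x on, the correction in [frobS] is at most a quarter of V_n;
    K absorbs the coefficients before. *)
Lemma frob_bound : exists2 K : R, 0 <= K &
  forall n, mxl1 (frob n) <= K * (5 / 4) ^+ n.
Proof.
pose c := mxl1 (1%:M : 'M[R[i]]_m) + mxl1 A'.
have c0 : 0 <= c by rewrite addr_ge0 ?mxl1_ge0.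
pose b := mxl1 (1%:M + B); have b0 : 0 <= b by exact: mxl1_ge0.
pose x := `|d| + 1 + 4 * (c * b).
have x0 : 0 <= x by rewrite !addr_ge0 ?mulr_ge0.
pose n0 := Num.bound x.
have n0P : x < n0%:R by have := archi_boundP x0.
pose K := \sum_(k < n0.+1) mxl1 (frob k).
have K0 : 0 <= K by apply: sumr_ge0 => k _; exact: mxl1_ge0.
exists K => //; elim=> [|n IH].
  rewrite expr0 mulr1 /K (bigD1 ord0)//= lerDl.
  by apply: sumr_ge0 => k _; exact: mxl1_ge0.
have [nn0|nn0] := leqP n.+1 n0.
  apply: (@le_trans _ _ K); last by rewrite ler_peMr// exprn_ege1// ler_pdivlMr// mul1r ler_nat.
  rewrite /K (bigD1 (Ordinal (nn0 : (n.+1 < n0.+1)%N)))//= lerDl.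
  by apply: sumr_ge0 => k _; exact: mxl1_ge0.
rewrite (frobS B A_split a12_nint n); apply: le_trans (mxl1D _ _) _; rewrite mxl1N.
have xn : x <= n.+1%:R by rewrite (le_trans (ltW n0P))// ler_nat ltnW.
have step : mxl1 (frob_inv n.+1 *m ((1%:M + B) *m frob n)) <= mxl1 (frob n) / 4.
  apply: le_trans (mxl1M _ _) _.
  apply: le_trans (ler_wpM2l (mxl1_ge0 _) (mxl1M _ _)) _.
  rewrite mulrA mulrC ler_wpM2l ?mxl1_ge0//.
  have xd : `|d| + 1 <= n.+1%:R.
    by rewrite (le_trans _ xn)// /x lerDl !mulr_ge0.
  apply: le_trans (ler_wpM2r b0 (frob_inv_bound (ltn0Sn n) xd)) _.
  rewrite -/c mulrAC ler_pdivrMr ?ltr0n// [leRHS]mulrC ler_pdivlMr// mulrC.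
  by rewrite (le_trans _ xn)// /x lerDr addr_ge0.
apply: le_trans (lerD (lexx _) step) _.
have -> : mxl1 (frob n) + mxl1 (frob n) / 4 = mxl1 (frob n) * (5 / 4) by lra.
by rewrite exprSr [leRHS]mulrA ler_wpM2r// divr_ge0.
Qed.

Lemma frob_residual_bound : exists2 K : R, 0 <= K & forall n,
  2^-1 ^+ n * mxl1 ((n%:R%:M - A') *m frob n) <= K * (25 / 32) ^+ n.
Proof.
have [K K0 KP] := frob_bound; have A0 := mxl1_ge0 A'.
exists ((4 + mxl1 A') * K) => [|n]; first by rewrite mulr_ge0// addr_ge0.
set q : R := 5 / 4.
have qn : (25 / 32) ^+ n = 2^-1 ^+ n * q ^+ n * q ^+ n.
  by rewrite -!exprMn /q; congr (_ ^+ n); field.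
have -> : (4 + mxl1 A') * K * (25 / 32) ^+ n =
    2^-1 ^+ n * (((4 + mxl1 A') * q ^+ n) * (K * q ^+ n)).
  by rewrite qn; ring.
rewrite ler_wpM2l ?exprn_ge0 ?invr_ge0// mulmxBl mul_scalar_mx.
have q1 : 1 <= q by rewrite ler_pdivlMr// mul1r ler_nat.
(* Bernoulli with q - 1 = 1/4: a second factor q^n pays for the factor n, whence 25/32 = (1/2)
   (5/4)^2. *)
have bern : n%:R <= 4 * q ^+ n.
  elim: (n) => [|k IH]; first by rewrite mulr_ge0// exprn_ge0// (le_trans ler01).
  have q1k : 1 <= q ^+ k by exact: exprn_ege1.
  rewrite -natr1 exprSr /q; move: (_ ^+ k) IH q1k => y; lra.
apply: le_trans (mxl1D _ _) _; rewrite mxl1N mxl1Z.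
have -> : normc (n%:R : R[i]) = n%:R.
  by rewrite -(rmorph_nat (real_complex R)) normc_real ger0_norm.
apply: le_trans (lerD (lexx _) (mxl1M _ _)) _; rewrite -mulrDl.
apply: ler_pM; rewrite ?addr_ge0 ?mxl1_ge0// mulrDl lerD//.
by rewrite ler_peMr// exprn_ege1.
Qed.

End FrobeniusBounds.

Section PartialSums.
Context {R : realType} {m : nat} (A B : 'M[R[i]]_m) (a1 a2 : R).
Hypothesis A_split : (A - a2%:C%:M) *m (A - a1%:C%:M) = 0.
Hypothesis a12_nint : a1 - a2 \isn't a Num.int.

Local Notation A' := (A - a2%:C%:M).
Local Notation V := (frob A B a1 a2).

(* The partial sums solve the system up to a single term of order x^N. *)
Lemma partial_sum_telescope (x : R[i]) (N : nat) :
  (1 + x) *: (\sum_(n < N) ((n%:R + a2%:C) * x ^+ n) *: V n) =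
  ((1 + x) *: A + x *: B) *m (\sum_(n < N) x ^+ n *: V n) -
  x ^+ N *: ((N%:R%:M - A') *m V N).
Proof.
elim: N => [|N IH].
  rewrite !big_ord0 scaler0 mulmx0 sub0r expr0 scale1r raddf0 sub0r mulNmx.
  by rewrite A_split !oppr0.
have VS := frobE B A_split a12_nint N.
rewrite [in RHS]VS {VS} big_ord_recr [in RHS]big_ord_recr.
rewrite [LHS]scalerDr IH [X in _ = X - _]mulmxDr.
move: (\sum_(i < N) _) (V N) => S v /=.
rewrite -scalemxAr.
have -> : ((1 + x) *: A + x *: B) *m v = (1 + x) *: (A *m v) + x *: (B *m v).
  by rewrite mulmxDl -!scalemxAl.
have -> : (N%:R%:M - A') *m v = N%:R *: v - A *m v + a2%:C *: v.
  by rewrite !mulmxBl !mul_scalar_mx opprB addrA addrAC.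
have -> : (A' + B - N%:R%:M) *m v = A *m v - a2%:C *: v + B *m v - N%:R *: v.
  by rewrite mulmxBl mulmxDl mulmxBl !mul_scalar_mx.
move: (_ *m S) (A *m v) (B *m v) => W P Q.
apply/matrixP => i j; rewrite !mxE exprS; ring.
Qed.

Local Notation x t := (- loop0 t).
Local Notation e t := (expi (2 * pi * a2 * t)).
Local Notation tau := (0 +i* (2 * pi : R)).

(** Along [loop1], z - 1 is x t and (z-1)^a2 is a constant times e t. One turn brings x back and
    multiplies e by e^(2 pi i a2), which is the monodromy. *)
Definition frob_sum (N : nat) (v : 'cV[R[i]]_m) (t : R) : 'cV[R[i]]_m :=
  e t *: ((\sum_(n < N) x t ^+ n *: V n) *m v).

(** The term left by the telescoping, divided by z (z-1) and multiplied by dz/dt = tau (z-1). *)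
Definition frob_residue (N : nat) (v : 'cV[R[i]]_m) (t : R) : 'cV[R[i]]_m :=
  - (tau * e t / (1 + x t) * x t ^+ N) *: ((N%:R%:M - A') *m V N *m v).

Lemma dloop0E (t : R) : dloop0 t = tau * loop0 t.
Proof. by rewrite /dloop0 /loop0 mulrCA. Qed.

Lemma vderive_frob_sum N v (t : R) : vderive (frob_sum N v) t
  ((- dloop0 t *: fuchs_coef A B (loop1 t)) *m frob_sum N v t +
   frob_residue N v t).
Proof.
have E : vderive (frob_sum N v) t
    ((tau * e t) *: ((\sum_(n < N) ((n%:R + a2%:C) * x t ^+ n) *: V n) *m v)).
  have dx : cderive (fun s => x s) t (tau * x t).
    have [dl _] := @regular_loop1 R.
    have := cderiveZ (-1) (cderiveZ 2^-1 (cderive_expi (2 * pi) t)).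
    rewrite mulN1r -/(dloop0 t) dloop0E mulrN.
    by congr cderive; apply/funext => s; exact: mulN1r.
  have de : cderive (fun s => e s) t (tau * a2%:C * e t).
    have := cderive_expi (2 * pi * a2) t; congr (cderive _ _ (_ * _)).
    by apply/eqP; rewrite eq_complex /= ?mul0r ?mulr0 ?subr0 ?addr0 ?add0r !eqxx.
  move=> k; have ZE (a : R[i]) (w : 'cV[R[i]]_m) : (a *: w) k 0 = a * w k 0.
    by rewrite mxE.
  have FE s : frob_sum N v s k 0 = \sum_(n < N) (V n *m v) k 0 * (e s * x s ^+ n).
    rewrite ZE mulmx_suml summxE mulr_sumr; apply: eq_bigr => n _.
    by rewrite -scalemxAl ZE mulrA mulrC.
  under eq_fun do rewrite FE.
  rewrite ZE mulmx_suml summxE mulr_sumr.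
  apply: cderive_sum => n _; rewrite -scalemxAl ZE; move: (V n *m v) => w.
  have := cderiveZ (w k 0) (cderiveM de (cderiveX n dx)).
  congr cderive; case: (nat_of_ord n) => [|j] /=; first by ring.
  by rewrite exprS -natr1; ring.
move: E; congr vderive.
have gam0 : 1 + x t != 0.
  apply: contraTneq (loop0_sub1 t) => h.
  by rewrite -normc_opp opprB h normc0 -ltNge invr_gt0.
have x0 : x t != 0.
  rewrite oppr_eq0; apply: contraTneq (ltr01 : (0 : R) < 1) => h.
  by have := normc_loop0 t; rewrite h normc0 => /esym/eqP; rewrite invr_eq0 pnatr_eq0.
have TS := partial_sum_telescope (x t) N.
rewrite /frob_sum /frob_residue /fuchs_coef dloop0E.
have -> : loop1 t - 1 = x t by rewrite /loop1 addrAC subrr add0r.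
have -> : loop1 t = 1 + x t by [].
move: TS; set S1 := \sum_(n < N) _; set S0 := \sum_(n < N) _ => TS.
have -> : S1 = (1 + x t)^-1 *: ((1 + x t) *: S1) by rewrite scalerA mulVf// scale1r.
rewrite TS -[in LHS]scalemxAl mulmxBl -[in LHS]mulmxA -[in LHS]scalemxAl.
have lin (a b : R[i]) (w : 'cV[R[i]]_m) :
    (a *: A + b *: B) *m w = a *: (A *m w) + b *: (B *m w).
  by rewrite mulmxDl -!scalemxAl.
rewrite lin -[in RHS]scalemxAl -[in RHS]scalemxAr lin.
move: (A *m (S0 *m v)) (B *m (S0 *m v)) (_ *m v) => P Q T.
have -> : - (tau * loop0 t) = tau * x t by rewrite mulrN.
move: (x t) gam0 x0 => y gam0 x0.
by apply/colP => i; rewrite !mxE; field; rewrite x0 gam0.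
Qed.

End PartialSums.

(** * Roots of unity and sequences tending to 0 *)

Section UnitCircle.
Context {R : realType}.

Lemma expi_int (n : int) : expi (2 * pi * n%:~R : R) = 1.
Proof.
have nat_case (k : nat) : expi (2 * pi * k%:R : R) = 1.
  elim: k => [|k IH]; first by rewrite mulr0 expi0.
  by rewrite -[k.+1%:R]natr1 mulrDr mulr1 expiD IH expi2pi mulr1.
case: n => k; first exact: nat_case.
rewrite NegzE mulrNz mulrN -[LHS]mulr1 -(nat_case k.+1) -expiD addNr expi0.
by rewrite nat_case.
Qed.

(** Passing to the fractional part y through e^(2 pi i x) = 1 avoids the sign (-1)^n; the sine of pi
    y is positive unless y = 0. *)
Lemma sin_pi_eq0 (x : R) : sin (pi * x) = 0 -> x \is a Num.int.
Proof.
move=> sx0; have /andP[nx xn] := floor_itv x; set n := Num.floor x in nx xn.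
have e1 : expi (2 * pi * x) = 1.
  apply/eqP; rewrite eq_complex /= -mulrA mulr_natl cos_mulr2n sin_mulr2n sx0.
  rewrite mulr0 mul0rn eqxx andbT; have := cos2Dsin2 (pi * x).
  by rewrite sx0 expr0n addr0 => ->; rewrite addrK.
pose y := x - n%:~R.
have : expi (2 * pi * y) = 1.
  have := expiD (2 * pi * y) (2 * pi * n%:~R).
  by rewrite expi_int mulr1 -mulrDr subrK e1.
rewrite -mulrA mulr_natl => -[+ _]; rewrite cos_mulr2n => c2.
have sy : sin (pi * y) = 0.
  apply/eqP; rewrite -sqrf_eq0; apply/eqP.
  have := cos2Dsin2 (pi * y); move: c2.
  by move: (cos _ ^+ 2) (sin _ ^+ 2) => u v uu uv; lra.
have [y0|y0] := eqVneq y 0.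
  by move: y0 => /eqP; rewrite subr_eq0 => /eqP ->; rewrite intr_int.
have : 0 < sin (pi * y).
  apply: sin_gt0_pi; rewrite mulr_gt0 ?pi_gt0//=; last first.
    by rewrite lt_def y0 subr_ge0.
  by rewrite gtr_pMr ?pi_gt0// /y ltrBlDl -[_ + 1]/(n%:~R + 1%:~R) -intrD.
by rewrite sy ltxx.
Qed.

Lemma expi_eq1 (x : R) : expi (2 * pi * x) = 1 -> x \is a Num.int.
Proof.
rewrite -mulrA mulr_natl => -[+ _]; rewrite cos_mulr2n => c2.
apply: sin_pi_eq0; apply/eqP; rewrite -sqrf_eq0; apply/eqP.
have := cos2Dsin2 (pi * x); move: c2.
by move: (cos _ ^+ 2) (sin _ ^+ 2) => u v uu uv; lra.
Qed.

Lemma expiN (x : R) : expi (- x) = (expi x)^-1.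
Proof.
have e : expi x * expi (- x) = 1 by rewrite -expiD subrr expi0.
have x0 : expi x != 0 by apply: contra_eq_neq e => ->; rewrite mul0r eq_sym oner_eq0.
by apply: (mulfI x0); rewrite e divff.
Qed.

Lemma expi_neq0 (x : R) : expi x != 0.
Proof.
apply/eqP => x0; have := normc_expi x; rewrite x0 normc0 => /esym/eqP.
by rewrite oner_eq0.
Qed.

Lemma expi_eq (x y : R) : expi (2 * pi * x) = expi (2 * pi * y) ->
  x - y \is a Num.int.
Proof.
move=> xy; apply: expi_eq1.
by rewrite mulrBr expiD expiN xy divff// expi_neq0.
Qed.

Lemma expiX (x : R) k : expi x ^+ k = expi (k%:R * x).
Proof.
elim: k => [|k IH]; first by rewrite mul0r expi0 expr0.
by rewrite exprS IH -expiD -[k.+1%:R]natr1 mulrDl mul1r addrC.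
Qed.

(** A discrete Cauchy formula, exact for polynomials of degree below N, hence for the N-th partial
    sum. The ratio w of the geometric sum is not 1, as N does not divide n. *)
Lemma sum_roots_of_unity (N n : nat) : (n < N)%N ->
  \sum_(k < N) (- loop0 (k%:R / N%:R : R)) ^+ n =
  if n == 0 then N%:R else 0.
Proof.
move=> nN; case: eqP => [->|/eqP n0].
  by under eq_bigr do rewrite expr0; rewrite sumr_const card_ord.
have N0 : N%:R != 0 :> R by rewrite pnatr_eq0 -lt0n (leq_ltn_trans _ nN).
pose w : R[i] := expi (2 * pi * (n%:R / N%:R)).
have -> : \sum_(k < N) (- loop0 (k%:R / N%:R : R)) ^+ n =
    (- 2^-1) ^+ n * \sum_(k < N) w ^+ k.
  rewrite mulr_sumr; apply: eq_bigr => k _.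
  rewrite /loop0 -mulNr exprMn /w !expiX; congr (_ * expi _).
  by rewrite !mulrA; congr (_ / _); ring.
have w1 : w - 1 != 0.
  rewrite subr_eq0; apply/eqP => /expi_eq1 /intrP[z zE].
  have zN : z%:~R * N%:R = n%:R :> R by rewrite -zE divfK.
  have : (z * N%:R = n%:R)%R.
    by apply: (@intr_inj R); rewrite intrM !natz -!pmulrn.
  rewrite !natz => /(congr1 absz); rewrite abszM !absz_nat => zn.
  have z0 : `|z|%N != 0 by apply: contra_neq n0 => z0; rewrite -zn z0.
  by move: nN; rewrite -zn ltnNge leq_pmull// lt0n.
apply/eqP; rewrite mulf_eq0; apply/orP; right.
rewrite -(mulrI_eq0 _ (mulfI w1)) -subrX1 subr_eq0 expiX mulrCA.
rewrite [N%:R * _]mulrC divfK//.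
by have := expi_int n; rewrite -pmulrn => ->.
Qed.

End UnitCircle.

Section Vanishing.
Context {R : realType}.
Implicit Types (u v : nat -> R).

Definition vanishing u := u @ \oo --> (0 : R).

Lemma vanishingD u v : vanishing u -> vanishing v ->
  vanishing (fun n => u n + v n).
Proof. by move=> u0 v0; have := cvgD u0 v0; rewrite addr0; apply. Qed.

Lemma vanishingZ (c : R) u : vanishing u -> vanishing (fun n => c * u n).
Proof. by move=> u0; have := cvgMl_tmp (a := c) u0; rewrite mulr0; apply. Qed.

Lemma vanishing_sqr u : vanishing u -> vanishing (fun n => u n ^+ 2).
Proof. by move=> u0; have := cvgM u0 u0; rewrite mulr0; apply. Qed.

Lemma vanishing_sum (I : Type) (r : seq I) (u : I -> nat -> R) :
  (forall i, vanishing (u i)) -> vanishing (fun n => \sum_(i <- r) u i n).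
Proof.
move=> u0; elim: r => [|i r IH].
  by rewrite /vanishing; under eq_fun do rewrite big_nil; exact: cvg_cst.
rewrite /vanishing; under eq_fun do rewrite big_cons.
exact: vanishingD.
Qed.

Lemma vanishing_le u v : (forall n, 0 <= u n <= v n) -> vanishing v ->
  vanishing u.
Proof.
move=> uv v0; apply: (@squeeze_cvgr _ _ _ _ (cst 0) v) => //.
  by apply: nearW.
exact: cvg_cst.
Qed.

Lemma le_vanishing (x : R) u : vanishing u ->
  (forall n, (0 < n)%N -> x <= u n) -> x <= 0.
Proof.
move=> u0 xu; have cu : cvgn u by apply/cvg_ex; exists 0.
have <- : limn u = 0 by apply: cvg_lim.
apply: limr_ge => //; near=> n; apply: xu; near: n.
exact: nbhs_infty_gt.
Unshelve. all: by end_near. Qed.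

End Vanishing.

Section EnergyBounds.
Context {R : realType} {m : nat}.
Implicit Types (v w : 'cV[R[i]]_m).

Lemma energyZ (a : R[i]) v : energy (a *: v) = normc a ^+ 2 * energy v.
Proof.
rewrite /energy mulr_sumr; apply: eq_bigr => k _.
by rewrite mxE normcM exprMn.
Qed.

Lemma energyD v w : energy (v + w) <= 2 * (energy v + energy w).
Proof.
rewrite /energy -big_split mulr_sumr ler_sum// => k _ /=.
rewrite mxE !normc_sqr complexReD complexImD.
move: (Re (v k 0)) (Re (w k 0)) (Im (v k 0)) (Im (w k 0)) => a b c d.
rewrite -subr_ge0.
have -> : 2 * (a ^+ 2 + c ^+ 2 + (b ^+ 2 + d ^+ 2)) -
  ((a + b) ^+ 2 + (c + d) ^+ 2) = (a - b) ^+ 2 + (c - d) ^+ 2 by ring.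
by rewrite addr_ge0// sqr_ge0.
Qed.

Lemma normc_sqr_le_energy v k : normc (v k 0) ^+ 2 <= energy v.
Proof.
by rewrite /energy (bigD1 k)//= lerDl sumr_ge0// => j _; rewrite sqr_ge0.
Qed.

End EnergyBounds.

(** * The series along the loop around 1 *)

Section LocalSolutions.
Context {R : realType} {m : nat} (A B : 'M[R[i]]_m) (a1 a2 : R).
Hypothesis A_split : (A - a2%:C%:M) *m (A - a1%:C%:M) = 0.
Hypothesis a12_nint : a1 - a2 \isn't a Num.int.

Local Notation A' := (A - a2%:C%:M).
Local Notation V := (frob A B a1 a2).
Local Notation psi := (frob_sum A B a1 a2).
Local Notation rho := (frob_residue A B a1 a2).

Lemma frob_residue_vanishing v : exists2 r : nat -> R, vanishing r &
  forall N t, energy (rho N v t) <= r N.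
Proof.
have [K K0 KP] := frob_residual_bound B A_split a12_nint.
pose q : R := 25 / 32.
have vq : vanishing (fun n => q ^+ n).
  apply: cvg_expr; rewrite ger0_norm ?divr_ge0//.
  by rewrite ltr_pdivrMr// mul1r ltr_nat.
(* The modulus of tau is 2 pi, and the other 2 bounds 1/|z|, since |z| >= 1/2 on the loop. *)
exists (fun N => ((2 * pi * 2) * K * mxl1 v * q ^+ N) ^+ 2).
  exact/vanishing_sqr/vanishingZ.
move=> N t; apply: le_trans (energy_le_mxl1 _) _.
rewrite ler_sqr ?nnegrE ?mxl1_ge0 ?mulr_ge0 ?pi_ge0 ?mxl1_ge0 ?exprn_ge0 ?divr_ge0//.
rewrite mxl1Z normc_opp !normcM normc_expi mulr1 normcV.
have -> : normc ((- loop0 t) ^+ N) = 2^-1 ^+ N.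
  elim: N => [|N IH]; first by rewrite !expr0 normc1.
  by rewrite !exprS normcM IH normc_opp normc_loop0.
have -> : normc (0 +i* (2 * pi : R)) = 2 * pi.
  by rewrite /= expr0n add0r sqrtr_sqr ger0_norm// mulr_ge0// pi_ge0.
have h : (normc (1 - loop0 t))^-1 <= 2.
  rewrite -[leRHS]invrK lef_pV2 ?posrE ?invr_gt0//.
    by rewrite -normc_opp opprB loop0_sub1.
  apply: lt_le_trans (_ : 2^-1 <= _); first by rewrite invr_gt0.
  by rewrite -normc_opp opprB loop0_sub1.
apply: le_trans (ler_wpM2l _ (mxl1M _ _)) _.
  by rewrite !mulr_ge0 ?pi_ge0 ?exprn_ge0 ?invr_ge0 ?normc_ge0.
have -> : 2 * pi * 2 * K * mxl1 v * q ^+ N =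
  (2 * pi * 2) * ((K * q ^+ N) * mxl1 v) by ring.
rewrite -!mulrA ler_wpM2l// ler_wpM2l ?pi_ge0//.
apply: ler_pM; rewrite ?invr_ge0 ?normc_ge0 ?mulr_ge0 ?exprn_ge0 ?invr_ge0 ?mxl1_ge0//.
by rewrite !mulrA ler_wpM2r ?mxl1_ge0.
Qed.

(** L is the sum of the matrix series at the base point, where the ratio is (1/2) (5/4) = 5/8.
    Convergence at this one point suffices; stability carries it along the loop. *)
Lemma frob_sum_limit : exists L : 'M[R[i]]_m, forall v,
  vanishing (fun N => energy (L *m v - psi N v 0)).
Proof.
have [K K0 KP] := frob_bound B A_split a12_nint.
pose x : R[i] := - loop0 0.
have nx n : normc (x ^+ n) = 2^-1 ^+ n.
  elim: n => [|N IH]; first by rewrite !expr0 normc1.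
  by rewrite !exprS normcM IH normc_opp normc_loop0.
have q01 : 0 <= (5 / 8 : R) < 1.
  by rewrite divr_ge0//= ltr_pdivrMr// mul1r ltr_nat.
have bnd (ij : 'I_m * 'I_m) n :
    normc (x ^+ n * V n ij.1 ij.2) <= K * (5 / 8) ^+ n.
  rewrite normcM nx.
  have -> : (5 / 8 : R) = 2^-1 * (5 / 4) by field.
  rewrite [in leRHS]exprMn mulrCA ler_wpM2l ?exprn_ge0 ?invr_ge0//.
  exact: le_trans (normc_le_mxl1 _ _ _) (KP n).
have [l lP] := choice (fun ij => complex_series_limit q01 (bnd ij)).
pose L := \matrix_(i, j) l (i, j); exists L => v.
pose S N := \sum_(n < N) x ^+ n *: V n.
have LS : vanishing (fun N => mxl1 (L - S N)).
  apply: vanishing_sum => i; apply: vanishing_sum => j.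
  have := lP (i, j); congr vanishing; apply/funext => N.
  by rewrite !mxE summxE; congr (normc (_ - _)); apply: eq_bigr => n _; rewrite mxE.
apply: (@vanishing_le _ _ (fun N => mxl1 v ^+ 2 * mxl1 (L - S N) ^+ 2)).
  move=> N; rewrite energy_ge0 /=.
  have -> : L *m v - psi N v 0 = (L - S N) *m v.
    by rewrite mulmxBl /frob_sum mulr0 expi0 scale1r.
  apply: le_trans (energy_le_mxl1 _) _; rewrite -exprMn mulrC.
  rewrite ler_sqr ?nnegrE ?mulr_ge0 ?mxl1_ge0//; exact: mxl1M.
exact/vanishingZ/vanishing_sqr.
Qed.

(** If f starts at L v, the truncations start near f and have small defects, so their ends approach
    the end of f; each end is e^(2 pi i a2) times the start. If L v = 0, the truncations are
    uniformly small on the whole loop, and so is their constant coefficient V_0 v. *)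
Lemma local_solutions : exists L : 'M[R[i]]_m,
  (forall M : solution A B -> solution A B, monodromy_operator loop1 M ->
     forall f v, base_value f = L *m v ->
       base_value (M f) = expi (2 * pi * a2) *: base_value f) /\
  (forall v : 'cV_m, L *m v = 0 -> (A - a1%:C%:M) *m v = 0).
Proof.
have [L LP] := frob_sum_limit; exists L; split.
  move=> M HM f v fv.
  have [r r0 rP] := frob_residue_vanishing v.
  have [C C0 stab] := continuation_stable A B regular_loop1.
  pose c : R[i] := expi (2 * pi * a2).
  have psi1 N : psi N v 1 = c *: psi N v 0.
    by rewrite /frob_sum mulr0 mulr1 expi0 scale1r /loop0 !mulr1 mulr0 expi2pi expi0.
  apply/eqP; rewrite -subr_eq0; apply/eqP/energy_eq0/eqP.
  rewrite eq_le energy_ge0 andbT.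
  apply: (@le_vanishing _ _ (fun N => 2 * (C * (energy (L *m v - psi N v 0) + r N)
     + energy (L *m v - psi N v 0)))).
    apply/vanishingZ/vanishingD; last exact: LP.
    by apply/vanishingZ/vanishingD; [exact: LP|].
  move=> N _.
  have r0N : 0 <= r N by apply: le_trans (energy_ge0 _) (rP N 0).
  have [|||w [_ w1]] := stab _ _ (HM f) (psi N v) (rho N v) (r N) r0N _ _ 1.
  - by move=> t _; exact: vderive_frob_sum.
  - by move=> t _; exact: rP.
  - by rewrite lexx ler01.
  rewrite w1// loop1_0 loop1_1 -/(base_value f) fv psi1 => we.
  have -> : base_value (M f) - c *: (L *m v) =
    (base_value (M f) - c *: psi N v 0) + c *: (- (L *m v - psi N v 0)).
    by rewrite scalerN scalerBr opprB addrA subrK.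
  apply: le_trans (energyD _ _) _.
  by rewrite ler_wpM2l// lerD// energyZ energyN normc_expi expr1n mul1r.
move=> v Lv.
have [r r0 rP] := frob_residue_vanishing v.
have [K K0 KW] := regular_path_bound A B regular_loop1.
pose C := expR (2 * m%:R * K + 1).
pose s N := C * (energy (L *m v - psi N v 0) + r N).
have psis N (t : R) : 0 <= t <= 1 -> energy (psi N v t) <= s N.
  move=> t01; rewrite /s Lv sub0r energyN.
  apply: (gronwall K0 _ _ KW _ t01) => [|t' _|t' _]; last exact: rP.
    by apply: le_trans (energy_ge0 _) (rP N 0).
  exact: vderive_frob_sum.
have s0 : vanishing s by apply/vanishingZ/vanishingD; [exact: LP|].
apply/colP => j; rewrite [RHS]mxE; apply/eq0_normc/eqP.
rewrite -sqrf_eq0 eq_le sqr_ge0 andbT; apply: le_vanishing s0 _ => N N0.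
have Nn0 : N%:R != 0 :> R[i] by rewrite pnatr_eq0 -lt0n.
pose t (k : 'I_N) : R := k%:R / N%:R.
have t01 k : 0 <= t k <= 1.
  rewrite divr_ge0//= ler_pdivrMr ?ltr0n// mul1r ler_nat.
  exact: ltnW.
(* Averaging over the N-th roots of unity extracts the constant coefficient. *)
have avg : (A - a1%:C%:M) *m v =
    N%:R^-1 *: \sum_(k < N) (expi (2 * pi * a2 * t k))^-1 *: psi N v (t k).
  have E k : (expi (2 * pi * a2 * t k))^-1 *: psi N v (t k) =
      \sum_(n < N) (- loop0 (t k)) ^+ n *: (V n *m v).
    rewrite scalerA mulVf ?expi_neq0// scale1r mulmx_suml.
    by apply: eq_bigr => n _; rewrite -scalemxAl.
  under eq_bigr do rewrite E.
  rewrite exchange_big /=.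
  under eq_bigr => n _ do rewrite -scaler_suml sum_roots_of_unity//.
  rewrite (bigD1 (Ordinal N0))//= big1 ?addr0.
    by rewrite scalerA mulVf// scale1r.
  by move=> n n0; rewrite ifN ?scale0r//.
have nN : normc (N%:R : R[i]) = N%:R.
  by rewrite -(rmorph_nat (real_complex R)) normc_real ger0_norm.
have s0N : 0 <= s N by apply: le_trans (energy_ge0 _) (psis N 0 _); rewrite lexx ler01.
rewrite -(sqr_sqrtr s0N) ler_sqr ?nnegrE ?normc_ge0 ?sqrtr_ge0//.
rewrite avg mxE summxE normcM normcV nN mulrC ler_pdivrMr ?ltr0n//.
apply: le_trans (normc_sum_le _ _ _) _.
have -> : Num.sqrt (s N) * N%:R = \sum_(k < N) Num.sqrt (s N).
  by rewrite sumr_const card_ord mulr_natr.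
rewrite ler_sum// => k _.
rewrite mxE normcM normcV normc_expi invr1 mul1r.
rewrite -ler_sqr ?nnegrE ?normc_ge0 ?sqrtr_ge0// sqr_sqrtr//.
exact: le_trans (normc_sqr_le_energy _ _) (psis N _ (t01 k)).
Qed.

End LocalSolutions.

(** * Linear algebra *)

Section LinearAlgebra.
Context {F : fieldType}.

Lemma char_poly_conj m (P A D : 'M[F]_m) : P \in unitmx ->
  P *m A = D *m P -> char_poly A = char_poly D.
Proof.
move=> uP PA; pose P' := map_mx polyC P.
have dP : \det P' != 0.
  by rewrite det_map_mx polyC_eq0; move: uP; rewrite unitmxE unitfE.
have H : P' *m char_poly_mx A = char_poly_mx D *m P'.
  rewrite /char_poly_mx mulmxBr mulmxBl mul_mx_scalar mul_scalar_mx.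
  by rewrite -!map_mxM PA.
by apply: (mulfI dP); rewrite -det_mulmx H det_mulmx mulrC.
Qed.

Lemma diagonalizable_two_eigenvalues m (A : 'M[F]_m) (a1 a2 : F) :
  a1 != a2 -> diagonalizable A ->
  char_poly A = ('X - a1%:P) * ('X - a2%:P) ^+ m.-1 ->
  (A - a2%:M) *m (A - a1%:M) = 0 /\ (m.-1 <= \rank (A - a1%:M)%R)%N.
Proof.
move=> a12 [P uP /(similar_diagLR uP)[d AE]] cA.
have {}AE : A = invmx P *m diag_mx d *m P.
  by rewrite AE conjVmx.
have PA : P *m A = diag_mx d *m P by rewrite AE !mulmxA mulmxV// mul1mx.
have ds : perm_eq [seq d 0 i | i : 'I_m] (a1 :: nseq m.-1 a2).
  apply: prod_XsubC_eq; rewrite big_cons big_map big_enum /=.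
  rewrite big_nseq -Monoid.iteropE /= -[RHS]cA (char_poly_conj uP PA).
  rewrite char_poly_trig ?diag_mx_is_trig//.
  by apply: eq_bigr => i _; rewrite mxE eqxx.
have dP i : d 0 i = a1 \/ d 0 i = a2.
  have : d 0 i \in a1 :: nseq m.-1 a2.
    by rewrite -(perm_mem ds); apply/mapP; exists i; rewrite ?mem_enum.
  by rewrite inE mem_nseq => /orP[/eqP|/andP[_ /eqP]]; [left|right].
have [i0 i0P iP] : exists2 i0, d 0 i0 = a1 & forall i, i != i0 -> d 0 i = a2.
  have : a1 \in [seq d 0 i | i : 'I_m] by rewrite (perm_mem ds) mem_head.
  move=> /mapP[i0 _ di0]; exists i0 => // i ii0.
  have [di|//] := dP i.
  (* The value a1 occurs once among the diagonal entries; a second index would make the count at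
     least two. *)
  have /permP/(_ (pred1 a1)) := ds; rewrite /= eqxx count_nseq /= eq_sym (negbTE a12).
  rewrite mul0n addn0 count_map => c1.
  pose Q := preim (fun j => d 0 j) (pred1 a1).
  have {}c1 : count Q (enum 'I_m) = 1%N by [].
  suff : (1 < count Q (enum 'I_m))%N by rewrite c1.
  rewrite -size_filter; have -> : 1%N = (size [:: i0]) by [].
  apply: (@leq_trans (size [:: i; i0])) => //.
  apply: uniq_leq_size; first by rewrite /= inE ii0.
  by move=> j; rewrite !inE mem_filter /= mem_enum andbT => /orP[]/eqP ->; rewrite ?di -?di0.
have sub a : A - a%:M = invmx P *m (diag_mx d - a%:M) *m P.
  by rewrite mulmxBr mulmxBl -AE mul_mx_scalar -scalemxAl mulVmx// scalemx1.
split.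
  rewrite !sub !mulmxA -[_ *m P *m invmx P]mulmxA mulmxV// mulmx1.
  rewrite -[invmx P *m _ *m _]mulmxA.
  suff -> : (diag_mx d - a2%:M) *m (diag_mx d - a1%:M) = 0.
    by rewrite mulmx0 mul0mx.
  rewrite -!diag_const_mx -!raddfB /= mulmx_diag.
  apply/matrixP => i j; rewrite !mxE.
  by have [->|->] := dP i; rewrite subrr ?mulr0 ?mul0r mul0rn.
pose D := diag_mx d - a1%:M.
have DA : (\rank D <= \rank (A - a1%:M)%R)%N.
  have -> : D = P *m (A - a1%:M) *m invmx P.
    by rewrite sub !mulmxA mulmxV// mul1mx -mulmxA mulmxV// mulmx1.
  exact: leq_trans (mxrankM_maxl _ _) (mxrankM_maxr _ _).
apply: leq_trans DA.
(* Filling the only zero on the diagonal of D makes it invertible at the cost of a matrix of rank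
   1. *)
have : \rank (D + delta_mx i0 i0)%R = m.
  apply/mxrank_unit; rewrite unitmxE unitfE.
  have -> : D + delta_mx i0 i0 = diag_mx (\row_j (if j == i0 then 1 else a2 - a1)).
    apply/matrixP => i j; rewrite !mxE.
    have [ij|ij] := eqVneq i j; last first.
      rewrite !mulr0n subr0 add0r.
      have [ii|//] := eqVneq i i0; have [ji|//] := eqVneq j i0.
      by rewrite ii ji eqxx in ij.
    rewrite -ij !mulr1n andbb.
    by have [ii|/iP ->] := eqVneq i i0; rewrite ?ii ?i0P ?subrr ?add0r ?addr0.
  rewrite det_diag prodf_seq_neq0; apply/allP => j _ /=.
  by rewrite mxE; case: ifP => _; rewrite ?oner_eq0// subr_eq0 eq_sym.
move=> rk; have := mxrank_add D (delta_mx i0 i0).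
by rewrite rk mxrank_delta addn1 -subn1 leq_subLR add1n.
Qed.

(** As a is not 0, r lies in the image of D and spans it. Transposes appear because [submx] compares
    row spaces. *)
Lemma rank1_col_space m (D : 'M[F]_m) (r : 'cV[F]_m) (a : F) :
  (\rank D <= 1)%N -> r != 0 -> a != 0 -> D *m r = a *: r ->
  forall x : 'cV_m, exists l, D *m x = l *: r.
Proof.
move=> rD r0 a0 Dr x.
have rr : \rank r^T = 1%N.
  apply/eqP; rewrite eqn_leq rank_leq_row lt0n mxrank_eq0.
  by apply: contra_neq r0 => /(congr1 trmx); rewrite trmxK trmx0.
have rsub : (r^T <= D^T)%MS.
  apply/submxP; exists (a^-1 *: r^T); rewrite -scalemxAl -trmx_mul Dr.
  by rewrite linearZ /= scalerA mulVf// scale1r.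
have Dsub : (D^T <= r^T)%MS.
  by rewrite -(geq_leqif (mxrank_leqif_sup rsub)) mxrank_tr rr.
have /sub_rVP[l lP] : (x^T *m D^T <= r^T)%MS.
  exact: submx_trans (submxMl _ _) Dsub.
exists l; apply: trmx_inj; rewrite trmx_mul lP linearZ; congr (_ *: _).
Qed.

Lemma ker_sub_rank m (L M : 'M[F]_m) :
  (forall v : 'cV_m, L *m v = 0 -> M *m v = 0) -> (\rank M <= \rank L)%N.
Proof.
move=> LM; rewrite -(mxrank_tr L) -(mxrank_tr M).
have : (kermx L^T <= kermx M^T)%MS.
  apply/rV_subP => u /sub_kermxP uL; apply/sub_kermxP.
  have : L *m u^T = 0 by rewrite -[L]trmxK -trmx_mul uL trmx0.
  by move=> /LM Mu; rewrite -[u]trmxK -trmx_mul Mu trmx0.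
move=> /mxrankS; rewrite !mxrank_ker => h.
have := rank_leq_row L^T; have := rank_leq_row M^T.
by move: h; move: (\rank _) (\rank _) => x y h hx hy; lia.
Qed.

End LinearAlgebra.

(** * Cauchy linear systems *)

Section Cauchy.
Context {F : fieldType} {m : nat}.

Lemma size_monic_sub (p q : {poly F}) n : p \is monic -> q \is monic ->
  size p = n.+1 -> size q = n.+1 -> (size (p - q)%R <= n)%N.
Proof.
move=> /monicP pm /monicP qm sp sq; apply/leq_sizeP => j nj.
rewrite coefB; have [jn|] := ltnP n j.
  by rewrite !nth_default ?sp ?sq// subrr.
move=> jn; have {nj jn}-> : j = n by apply/eqP; rewrite eqn_leq jn.
by move: pm qm; rewrite !lead_coefE sp sq /= => -> ->; rewrite subrr.
Qed.

(* The monic polynomial prod (t - X_k) + sum_j s_j prod_(k != j) (t - X_k)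
   vanishes at every Y_i, hence is prod (t - Y_i); evaluate it at X_j. *)
Lemma cauchy_solution (X Y s : 'I_m -> F) : injective Y ->
  (forall i j, X j - Y i != 0) ->
  (forall i, \sum_j s j / (X j - Y i) = 1) ->
  forall j, s j * \prod_(k < m | k != j) (X j - X k) = \prod_i (X j - Y i).
Proof.
move=> injY XY sXY j.
pose p := \prod_k ('X - (X k)%:P); pose q := \prod_k ('X - (Y k)%:P).
pose t := \sum_l s l *: \prod_(k < m | k != l) ('X - (X k)%:P).
have szp (Z : 'I_m -> F) : size (\prod_k ('X - (Z k)%:P)) = m.+1.
  by rewrite size_prod_XsubC /index_enum -enumT size_enum_ord.
have szt : (size t <= m)%N.
  apply: leq_trans (size_sum _ _ _) _; apply/bigmax_leqP => l _.
  apply: leq_trans (size_scale_leq _ _) _.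
  rewrite -big_filter size_prod_XsubC size_filter.
  have := count_predC (pred1 l) (index_enum 'I_m).
  rewrite (count_uniq_mem _ (index_enum_uniq _)) mem_index_enum add1n.
  by rewrite /index_enum -enumT size_enum_ord => ->.
have q0 : p - q + t = 0.
  have rs : uniq [seq Y i | i : 'I_m] by rewrite map_inj_uniq// enum_uniq.
  apply: (roots_geq_poly_eq0 _ rs).
    apply/allP => _ /mapP[i _ ->]; rewrite rootE !hornerD hornerN.
    rewrite [q](bigD1 i)//= hornerM hornerXsubC subrr mul0r subr0.
    have -> : t.[Y i] = - p.[Y i].
      rewrite -[p.[Y i]]mulr1 -(sXY i) mulr_sumr -sumrN horner_sum.
      apply: eq_bigr => l _; rewrite hornerZ [p](bigD1 l)//= hornerM hornerXsubC.
      by field; exact: XY.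
    by rewrite subrr.
  rewrite size_map size_enum_ord; apply: leq_trans (size_polyD _ _) _.
  by rewrite geq_max szt (size_monic_sub _ _ (szp X) (szp Y)) ?monic_prod_XsubC.
have : (p - q + t).[X j] = 0 by rewrite q0 horner0.
rewrite !hornerD hornerN [p](bigD1 j)//= hornerM hornerXsubC subrr mul0r sub0r.
rewrite horner_sum (bigD1 j)//= [\sum_(l < m | l != j) _]big1 ?addr0; last first.
  move=> l lj; rewrite hornerZ (bigD1 j) 1?eq_sym//= hornerM hornerXsubC subrr.
  by rewrite mul0r mulr0.
have hp (P : pred 'I_m) (Z : 'I_m -> F) a :
    (\prod_(k | P k) ('X - (Z k)%:P)).[a] = \prod_(k | P k) (a - Z k).
  by rewrite horner_prod; apply: eq_bigr => k _; rewrite hornerXsubC.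
by rewrite hornerZ /q !hp addrC => /eqP; rewrite subr_eq0 => /eqP.
Qed.

End Cauchy.

(** * Eigenbases and coordinates *)

Section LinearMaps.
Context {F : pzRingType} {V W : lmodType F} (f : V -> W).
Hypothesis linf : linear f.

Lemma linear_map0 : f 0 = 0.
Proof. by have := linf (-1) 0 0; rewrite scaler0 addr0 scaleN1r addNr. Qed.

Lemma linear_mapZ a u : f (a *: u) = a *: f u.
Proof. by have := linf a u 0; rewrite linear_map0 !addr0. Qed.

Lemma linear_map_comb (I : Type) (r : seq I) (P : pred I) (x : I -> F) (u : I -> V) :
  f (\sum_(i <- r | P i) x i *: u i) = \sum_(i <- r | P i) x i *: f (u i).
Proof.
by elim/big_rec2 : _ => [|i y z _ <-]; [exact: linear_map0|exact: linf].
Qed.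

End LinearMaps.

Section Eigenbasis.
Context {F : fieldType} {m : nat} {V : lmodType F} (ev : {linear V -> 'cV[F]_m}).
Hypothesis ev_inj : injective ev.

(** Applying f(M) to a relation multiplies its coefficients by f(be_j); the Lagrange polynomial that
    vanishes at all eigenvalues except be_i isolates x_i. *)
Lemma eigenvectors_free (M : V -> V) (be : 'I_m -> F) (p : 'I_m -> V) :
  linear M -> injective be -> (forall i, p i != 0 /\ M (p i) = be i *: p i) ->
  forall x : 'I_m -> F, \sum_i x i *: p i = 0 -> forall i, x i = 0.
Proof.
move=> linM inj_be Mp x xp i.
have lin_sum (y : 'I_m -> F) :
    M (\sum_j y j *: p j) = \sum_j (y j * be j) *: p j.
  by rewrite linear_map_comb//; apply: eq_bigr => j _; rewrite (Mp j).2 scalerA.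
have polyx (f : {poly F}) : \sum_j (x j * f.[be j]) *: p j = 0.
  elim/poly_ind : f => [|f a IH].
    by rewrite big1// => j _; rewrite horner0 mulr0 scale0r.
  transitivity (M (\sum_j (x j * f.[be j]) *: p j) + a *: \sum_j x j *: p j).
    rewrite lin_sum scaler_sumr -big_split; apply: eq_bigr => j _ /=.
    by rewrite scalerA -scalerDl hornerMXaddC; congr (_ *: _); ring.
  by rewrite IH xp linear_map0// scaler0 addr0.
have := polyx (\prod_(k < m | k != i) ('X - (be k)%:P)).
rewrite (bigD1 i)//= [\sum_(l < m | l != i) _]big1 => [|j ji]; last first.
  by rewrite horner_prod (bigD1 j)//= hornerXsubC subrr mul0r mulr0 scale0r.
move=> /eqP; rewrite addr0 scaler_eq0 (negbTE (Mp i).1) orbF mulf_eq0.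
case/orP => [/eqP//|]; rewrite horner_prod prodf_seq_eq0 => /hasP[k _].
rewrite hornerXsubC subr_eq0 => /andP[ki /eqP/inj_be ik].
by rewrite ik eqxx in ki.
Qed.

(** Injectivity of ev bounds the dimension of V by m and the free family bounds it below, so ev is
    bijective. For solutions this makes every vector of C^m a base value. *)
Lemma free_coordinates (p : 'I_m -> V) :
  (forall x : 'I_m -> F, \sum_i x i *: p i = 0 -> forall i, x i = 0) ->
  exists co : {linear V -> 'cV[F]_m},
    [/\ forall f, f = \sum_i co f i 0 *: p i,
        forall i j, co (p i) j 0 = (i == j)%:R &
        forall v, exists f, ev f = v].
Proof.
move=> free; pose P := \matrix_(k, i) ev (p i) k 0.
have evP (x : 'cV_m) : ev (\sum_i x i 0 *: p i) = P *m x.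
  rewrite linear_sum; apply/colP => k; rewrite summxE mxE.
  by apply: eq_bigr => i _; rewrite linearZ !mxE mulrC.
have uP : P \in unitmx.
  rewrite -unitmx_tr -row_free_unit -kermx_eq0; apply/eqP/row_matrixP => k.
  rewrite row0; set u := row k _.
  have uP0 : P *m u^T = 0.
    apply: trmx_inj; rewrite trmx_mul trmxK trmx0.
    by apply/sub_kermxP; exact: row_sub.
  have /free u0 : \sum_i u^T i 0 *: p i = 0.
    by apply: ev_inj; rewrite evP uP0 linear0.
  by apply/rowP => i; have := u0 i; rewrite !mxE.
exists (mulmx (invmx P) \o ev); split => [f|i j|v].
- by apply: ev_inj; rewrite evP /= mulKVmx.
- have evp : ev (p i) = P *m delta_mx i 0.
    by rewrite -colE; apply/colP => k; rewrite !mxE.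
  by rewrite /= evp mulKmx// mxE andbT eq_sym.
- by exists (\sum_i (invmx P *m v) i 0 *: p i); rewrite evP mulKVmx.
Qed.

End Eigenbasis.

(** * Products of differences of exponentials *)

Section TrigonometricProducts.
Context {R : realType}.

Lemma expi_sub (x y : R) : expi (2 * pi * x) - expi (2 * pi * y) =
  (0 +i* 2) * expi (pi * (x + y)) * (sin (pi * (x - y)))%:C.
Proof.
have -> : 2 * pi * x = pi * (x + y) + pi * (x - y) by ring.
have -> : 2 * pi * y = pi * (x + y) - pi * (x - y) by ring.
move: (pi * (x + y)) (pi * (x - y)) => u v.
by apply/eqP; rewrite eq_complex /= cosD sinD cosB sinB; apply/andP; split;
  apply/eqP; ring.
Qed.

Lemma expi_sum (I : Type) (r : seq I) (P : pred I) (F : I -> R) :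
  expi (\sum_(i <- r | P i) F i) = \prod_(i <- r | P i) expi (F i).
Proof.
by elim/big_rec2 : _ => [|i x y _ <-]; rewrite ?expi0 ?expiD.
Qed.

Lemma prod_expi_sub (I : finType) (P : pred I) (x y : I -> R) :
  \prod_(i | P i) (expi (2 * pi * x i) - expi (2 * pi * y i)) =
  (0 +i* 2) ^+ #|P| * expi (pi * \sum_(i | P i) (x i + y i)) *
    (\prod_(i | P i) sin (pi * (x i - y i)))%:C.
Proof.
rewrite mulr_sumr expi_sum rmorph_prod -prodr_const -!big_split /=.
by apply: eq_bigr => i _; exact: expi_sub.
Qed.

End TrigonometricProducts.

(** * Invariant hermitian forms *)

Section DiagonalForm.
Context {R : realType} {m : nat} {V : lmodType R[i]}.
Local Notation cj := (@Num.conj R[i]).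

Lemma conj_real (k : R) : cj k%:C = k%:C.
Proof. by apply/eqP; rewrite eq_complex /= oppr0 !eqxx. Qed.

Definition diag_form (nu : 'I_m -> R) (co : {linear V -> 'cV[R[i]]_m})
    (u v : V) : R[i] :=
  \sum_i (nu i)%:C * (co u i 0 * cj (co v i 0)).

Fact diag_form_bilinear nu co :
  bilinear_for *%R (cj \; *%R) (diag_form nu co).
Proof.
split=> w a u v; rewrite /= /diag_form mulr_sumr -big_split;
  apply: eq_bigr => i _ /=; rewrite linearP !mxE; first by ring.
by rewrite rmorphD rmorphM /=; ring.
Qed.

HB.instance Definition _ nu co := bilinear_isBilinear.Build R[i] V V R[i]
  *%R (cj \; *%R) (diag_form nu co) (diag_form_bilinear nu co).

Fact diag_form_hermitian nu co (u v : V) :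
  diag_form nu co u v = (-1) ^+ false * cj (diag_form nu co v u).
Proof.
rewrite expr0 mul1r rmorph_sum; apply: eq_bigr => i _ /=.
by rewrite !rmorphM /= conjCK conj_real; ring.
Qed.

HB.instance Definition _ nu co := isHermitianSesquilinear.Build R[i] V false cj
  (diag_form nu co) (diag_form_hermitian nu co).

End DiagonalForm.

Section HermitianProducts.
Context {R : realType} {V : lmodType R[i]} (h : hermitian_product V).
Local Notation cj := (@Num.conj R[i]).

Lemma herm_sym u v : h u v = cj (h v u).
Proof. by rewrite [LHS]hermitian_subproof expr0 mul1r. Qed.

Lemma herm_suml I (s : seq I) (P : pred I) (F : I -> V) v :
  h (\sum_(i <- s | P i) F i) v = \sum_(i <- s | P i) h (F i) v.
Proof. exact: linear_sumlz. Qed.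

Lemma herm_sumr I (s : seq I) (P : pred I) (F : I -> V) v :
  h v (\sum_(i <- s | P i) F i) = \sum_(i <- s | P i) h v (F i).
Proof. exact: linear_sumr. Qed.

Lemma hermZl a u v : h (a *: u) v = a * h u v.
Proof. exact: linearZl_LR. Qed.

Lemma hermZr a u v : h u (a *: v) = cj a * h u v.
Proof. exact: linearZr_LR. Qed.

Lemma hermDl u u' v : h (u + u') v = h u v + h u' v.
Proof. exact: linearDl. Qed.

End HermitianProducts.

Section ComplexReflection.
Context {R : realType} {m : nat} {V : lmodType R[i]}.
Local Notation cj := (@Num.conj R[i]).
Variables (p : 'I_m -> V) (co : {linear V -> 'cV[R[i]]_m}).
Variables (M0 M1 : V -> V) (be : 'I_m -> R[i]) (al1 al2 kappa : R[i]).
Variables (nu : 'I_m -> R) (l : V -> R[i]) (i0 : 'I_m).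
Local Notation r := (\sum_i p i).
Local Notation N := (\sum_i nu i).

Hypothesis pE : forall f, f = \sum_i co f i 0 *: p i.
Hypothesis co_p : forall i j, co (p i) j 0 = (i == j)%:R.
Hypothesis M1E : forall f, M1 f = al2 *: f + l f *: r.
Hypothesis linM1 : linear M1.
Hypothesis M1r : M1 r = al1 *: r.
Hypothesis al12 : al1 != al2.
Hypothesis al1_unit : al1 * cj al1 = 1.
Hypothesis al2_unit : al2 * cj al2 = 1.
Hypothesis l_p : forall i, l (p i) = kappa * (nu i)%:C.

Lemma co_r i : co r i 0 = 1.
Proof.
rewrite linear_sum summxE (bigD1 i)//= co_p eqxx big1 ?addr0// => j ji.
by rewrite co_p (negbTE ji).
Qed.

Lemma coM1 f i : co (M1 f) i 0 = al2 * co f i 0 + l f.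
Proof. by rewrite M1E linearD !linearZ !mxE co_r mulr1. Qed.

(** Nothing but [M1E] describes l; since r has all coordinates 1, any coordinate of M1 f - al2 f
    recovers l f. *)
Lemma reflection_functional_linear a f g : l (a *: f + g) = a * l f + l g.
Proof.
have lE f' : l f' = co (M1 f') i0 0 - al2 * co f' i0 0 by rewrite coM1 addrAC subrr add0r.
by rewrite !lE linM1 !linearP !mxE; ring.
Qed.

Lemma reflection_functionalE f : l f = kappa * \sum_i (nu i)%:C * co f i 0.
Proof.
rewrite {1}(pE f).
rewrite (linear_map_comb (reflection_functional_linear : linear (l : V -> R[i]^o))).
by rewrite mulr_sumr; apply: eq_bigr => i _; rewrite l_p [_ *: _]mulrC -mulrA.
Qed.

(** Both sides are l r. In particular N is not 0. *)
Lemma reflection_eigenvalue : al1 - al2 = kappa * N%:C.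
Proof.
have lr : l r = al1 - al2.
  by have := coM1 r i0; rewrite M1r linearZ mxE co_r !mulr1 => ->; rewrite addrAC subrr add0r.
rewrite -lr reflection_functionalE rmorph_sum; congr (_ * _).
by apply: eq_bigr => i _; rewrite co_r mulr1.
Qed.

Lemma diag_form_p i j :
  diag_form nu co (p i) (p j) = (if i == j then nu i else 0)%:C.
Proof.
rewrite /diag_form (bigD1 i)//= co_p eqxx mul1r big1 => [|k ki]; last first.
  by rewrite co_p eq_sym (negbTE ki) mul0r mulr0.
rewrite co_p addr0 eq_sym; case: eqP => _; last by rewrite rmorph0 mulr0.
by rewrite rmorph1 mulr1.
Qed.

Lemma coM0 f i : linear M0 -> (forall i, M0 (p i) = be i *: p i) ->
  co (M0 f) i 0 = be i * co f i 0.
Proof.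
move=> lin0 M0p; rewrite {1}(pE f) linear_map_comb// linear_sum summxE.
rewrite (bigD1 i)//= M0p !linearZ !mxE co_p eqxx mulr1 mulrC.
rewrite big1 ?addr0// => j ji.
by rewrite M0p !linearZ !mxE co_p (negbTE ji) !mulr0.
Qed.

Lemma diag_form_M0 : linear M0 -> (forall i, M0 (p i) = be i *: p i) ->
  (forall i, be i * cj (be i) = 1) -> invariant_under (diag_form nu co) M0.
Proof.
move=> lin0 M0p be1 u v.
apply: eq_bigr => i _; rewrite !coM0// rmorphM /=.
rewrite [X in _ * X](_ : _ = be i * cj (be i) * (co u i 0 * cj (co v i 0))).
  by rewrite be1 mul1r.
ring.
Qed.

(* Invariance amounts to |al2 + kappa N| = |al2|, and al2 + kappa N = al1. *)
Lemma diag_form_M1 : invariant_under (diag_form nu co) M1.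
Proof.
move=> u v.
pose S f := \sum_i (nu i)%:C * co f i 0.
have lE f : l f = kappa * S f := reflection_functionalE f.
have cjS f : cj (S f) = \sum_i (nu i)%:C * cj (co f i 0).
  by rewrite rmorph_sum; apply: eq_bigr => i _; rewrite rmorphM /= conj_real.
have -> : diag_form nu co (M1 u) (M1 v) =
    al2 * cj al2 * diag_form nu co u v + al2 * cj (l v) * S u +
    cj al2 * l u * cj (S v) + l u * cj (l v) * N%:C.
  rewrite cjS rmorph_sum !mulr_sumr -!big_split; apply: eq_bigr => i _ /=.
  by rewrite !coM1 !rmorphD !rmorphM /=; ring.
rewrite al2_unit mul1r !lE !rmorphM /=; move: (S u) (cj (S v)) => x y.
have N0 : N%:C != 0.
  apply: contra_neq al12 => N0; apply/eqP; rewrite -subr_eq0.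
  by rewrite reflection_eigenvalue N0 mulr0.
have cN : cj al1 - cj al2 = cj kappa * N%:C.
  by rewrite -rmorphB reflection_eigenvalue rmorphM /= conj_real.
have key : al2 * cj kappa + cj al2 * kappa + kappa * cj kappa * N%:C = 0.
  apply: (mulIf N0); rewrite mul0r.
  have -> : (al2 * cj kappa + cj al2 * kappa + kappa * cj kappa * N%:C) * N%:C =
    al2 * (cj kappa * N%:C) + cj al2 * (kappa * N%:C) +
    (kappa * N%:C) * (cj kappa * N%:C) by ring.
  rewrite -cN -reflection_eigenvalue.
  have -> : al2 * (cj al1 - cj al2) + cj al2 * (al1 - al2) +
    (al1 - al2) * (cj al1 - cj al2) = al1 * cj al1 - al2 * cj al2 by ring.
  by rewrite al1_unit al2_unit subrr.
rewrite -!addrA -[RHS]addr0; congr (_ + _).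
transitivity ((al2 * cj kappa + cj al2 * kappa + kappa * cj kappa * N%:C) * (x * y)).
  by ring.
by rewrite key mul0r.
Qed.

(** Orthogonality gives h(p_i, r) = h(p_i, p_i), and invariance on the pair (p_i, r) becomes (al1 -
    al2) h(p_i, p_i) = kappa nu_i h(r, r). Hence the constant is h(r, r) / N, real because h is
    hermitian. *)
Lemma invariant_form_unique (h : hermitian_product V) :
  kappa != 0 -> invariant_under h M1 -> orthogonal_family h p ->
  exists k : R, forall u v, h u v = k%:C * diag_form nu co u v.
Proof.
move=> kappa0 hM1 orth.
have hpr i : h (p i) r = h (p i) (p i).
  rewrite herm_sumr (bigD1 i)//= big1 ?addr0// => j ji.
  by rewrite orth// eq_sym.
have N0 : N != 0.
  apply: contra_neq al12 => N0; apply/eqP; rewrite -subr_eq0.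
  by rewrite reflection_eigenvalue N0 mulr0.
have N0C : N%:C != 0 by apply: contra_neq N0 => /complexI.
have hrr : h r r = (Re (h r r))%:C.
  have := herm_sym h r r; case: (h r r) => a b [bb].
  by apply/eqP; rewrite eq_complex /= eqxx /=; apply/eqP; move: bb; lra.
have hii i : h (p i) (p i) = (Re (h r r) / N)%:C * (nu i)%:C.
  have -> : (Re (h r r) / N)%:C = h r r / N%:C by rewrite rmorphM fmorphV /= -hrr.
  apply: (mulIf N0C); rewrite mulrAC divfK//.
  have := hM1 (p i) r; rewrite M1r M1E hermZr hermDl !hermZl hpr l_p.
  move=> /(congr1 (fun x => al1 * x)); rewrite mulrA al1_unit mul1r => E.
  have : (al1 - al2) * h (p i) (p i) = kappa * (nu i)%:C * h r r.
    by rewrite mulrBl -E; ring.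
  rewrite reflection_eigenvalue -!mulrA => /(mulfI kappa0) H.
  by rewrite mulrC H mulrC.
exists (Re (h r r) / N) => u v; move: (Re (h r r) / N) hii => k hii.
rewrite {1}(pE u) herm_suml /diag_form mulr_sumr; apply: eq_bigr => i _.
rewrite {1}(pE v) herm_sumr (bigD1 i)//= big1 ?addr0 => [|j ji]; last first.
  by rewrite hermZl hermZr orth ?mulr0// eq_sym.
by rewrite hermZl hermZr hii; ring.
Qed.

End ComplexReflection.

Lemma linear_matrix (F : fieldType) (m : nat) (V : lmodType F)
    (ev W : {linear V -> 'cV[F]_m}) : injective ev ->
  (forall v, exists f, ev f = v) -> exists D, forall f, D *m ev f = W f.
Proof.
move=> ev_inj ev_surj.
have [s sP] := choice (fun j => ev_surj (delta_mx j 0)).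
exists (\matrix_(k, j) W (s j) k 0) => f.
have fE : f = \sum_j ev f j 0 *: s j.
  apply: ev_inj; rewrite linear_sum; apply/colP => k; rewrite summxE (bigD1 k)//=.
  rewrite linearZ sP !mxE eqxx mulr1 big1 ?addr0// => j jk.
  by rewrite linearZ sP !mxE eq_sym (negbTE jk) mulr0.
rewrite [in RHS]fE linear_sum.
apply/colP => k; rewrite mxE summxE; apply: eq_bigr => j _.
by rewrite linearZ !mxE mulrC.
Qed.

(** * Solutions of Cauchy systems as ratios of sines *)

Section Trigonometry.
Context {R : realType} {m : nat}.

Lemma sin_pi_neq0 (x : R) : x \isn't a Num.int -> sin (pi * x) != 0.
Proof. by apply: contraNneq; exact: sin_pi_eq0. Qed.

(** With m factors on the right and m - 1 on the left, one 2i survives. The half-sum phases differ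
    by 2x + sum y - sum z, one x coming from the extra factor and one from the missing z_i = x. *)
Lemma trig_ratio (x : R) (y z : 'I_m -> R) (i : 'I_m) (w : R[i]) :
  z i = x -> (forall k, k != i -> x - z k \isn't a Num.int) ->
  w * \prod_(k < m | k != i) (expi (2 * pi * x) - expi (2 * pi * z k)) =
    \prod_(k < m) (expi (2 * pi * x) - expi (2 * pi * y k)) ->
  w = (0 +i* 2) * expi (pi * (2 * x + (\sum_k y k - \sum_k z k))) *
    (\prod_k sin (pi * (x - y k)) /
     \prod_(k < m | k != i) sin (pi * (x - z k)))%:C.
Proof.
move=> zi xz; rewrite !(prod_expi_sub _ (fun=> x)).
set T : R[i] := 0 +i* 2; set q := \prod_(k < m | _) _; set q' := \prod_k _.
have T0 : T != 0 by rewrite eq_complex /= eqxx pnatr_eq0.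
have q0 : q%:C != 0.
  rewrite -[0]/(0%:C) (inj_eq (@complexI _)) prodf_seq_neq0; apply/allP => k _.
  by apply/implyP => /xz; exact: sin_pi_neq0.
have -> : #|(fun k : 'I_m => k != i)| = m.-1.
  by have := cardC1 i; rewrite card_ord => <-; apply: eq_card.
have -> : #|(fun=> true) : pred 'I_m| = m by rewrite -[RHS]card_ord; apply: eq_card.
have mT : T ^+ m = T ^+ m.-1 * T by rewrite -exprSr prednK// (leq_ltn_trans _ (ltn_ord i)).
set e1 := expi (pi * \sum_(k < m | k != i) _); set e2 := expi (pi * \sum_k _).
have ee : e2 = e1 * expi (pi * (2 * x + (\sum_k y k - \sum_k z k))).
  rewrite /e1 /e2 -expiD -mulrDr; congr (expi (_ * _)).
  have := bigD1 (op := +%R) (x := 0) (P := predT) i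
    (F := fun k => x + z k) (erefl true).
  rewrite /= zi !big_split /= => /eqP; rewrite eq_sym addrC -subr_eq => /eqP <-.
  ring.
move=> H; apply: (mulIf (_ : T ^+ m.-1 * e1 * q%:C != 0)).
  by rewrite !mulf_neq0 ?expf_neq0 ?expi_neq0.
by rewrite H mT ee rmorphM fmorphV /=; field.
Qed.

End Trigonometry.

Lemma trace_of_roots (F : comNzRingType) (m : nat) (A : 'M[F]_m) (s : seq F) :
  (0 < m)%N -> size s = m -> char_poly A = \prod_(x <- s) ('X - x%:P) ->
  \tr A = \sum_(x <- s) x.
Proof.
move=> m0 sm cA; apply: oppr_inj; rewrite -char_poly_trace// cA -sm.
by rewrite coefPn_prod_XsubC// sm -lt0n.
Qed.

(** * The monodromy around 1, the trace relation and the theorem *)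

Section Reflection.
Context {R : realType} {m : nat} {A B : 'M[R[i]]_m}.
Local Notation sol := (solution A B).

Lemma monodromy_reflection (a1 a2 : R) (M : sol -> sol) (r : sol) :
  (A - a2%:C%:M) *m (A - a1%:C%:M) = 0 -> (m.-1 <= \rank (A - a1%:C%:M)%R)%N ->
  a1 - a2 \isn't a Num.int -> monodromy_operator loop1 M ->
  (forall v, exists f : sol, base_value f = v) ->
  r != 0 -> M r = expi (2 * pi * a1) *: r ->
  exists l : sol -> R[i],
    forall f, M f = expi (2 * pi * a2) *: f + l f *: r.
Proof.
move=> A_split rk nint HM surj r0 Mr.
have linM := monodromy_linear regular_loop1 loop1_0 loop1_1 HM.
have [L [LM Lker]] := local_solutions B A_split nint.
pose W f := base_value (M f) - expi (2 * pi * a2) *: base_value f.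
have linW : linear W.
  move=> a f g; rewrite /W linM !base_value_linear scalerBr scalerDr !scalerA.
  by rewrite [_ * a]mulrC opprD addrACA.
pose W' : {linear sol -> 'cV[R[i]]_m} :=
  HB.pack W (GRing.isLinear.Build _ _ _ _ W linW).
have [D DW] := linear_matrix W' base_value_inj surj.
have {}DW f : D *m base_value f = W f := DW f.
(* Each column of L is the base value of a solution, which M multiplies by e^(2 pi i a2). *)
have DL : D *m L = 0.
  apply/row_matrixP => i; apply/rowP => j; rewrite !mxE.
  have [f fL] := surj (L *m delta_mx j 0).
  have := DW f; rewrite /W (LM M HM f _ fL) subrr fL mulmxA.
  by rewrite -colE => /colP/(_ i); rewrite !mxE.
have rD : (\rank D <= 1)%N.
  have := mulmx0_rank_max DL; have := ker_sub_rank Lker; move: rk.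
  move: (\rank _) (\rank _) (\rank _) => x y z; lia.
have br0 : base_value r != 0.
  by apply: contra_neq r0 => br; apply: base_value_inj; rewrite br linear0.
have al0 : expi (2 * pi * a1) - expi (2 * pi * a2) != 0.
  by rewrite subr_eq0; apply: contraNneq nint => /expi_eq.
have Dr : D *m base_value r =
    (expi (2 * pi * a1) - expi (2 * pi * a2)) *: base_value r.
  by rewrite DW /= /W Mr linearZ scalerBl.
have ex (f : sol) : exists c : R[i], D *m base_value f = c *: base_value r.
  exact: rank1_col_space rD br0 al0 Dr (base_value f).
have [l lP] := choice ex.
exists l => f; apply: base_value_inj; rewrite linearD !linearZ /= -lP DW /= /W.
by rewrite addrC subrK.
Qed.

End Reflection.

(** Traces of A + B + C = 0. The relation removes the sums of exponents from the phases of the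
    Cauchy solutions, so that kappa does not depend on i. *)
Lemma exponent_trace (R : realType) (m : nat) (A B C : 'M[R[i]]_m) (a1 a2 : R)
    (b c : 'I_m -> R) : (0 < m)%N -> A + B + C = 0 ->
  char_poly A = ('X - (a1%:C)%:P) * ('X - (a2%:C)%:P) ^+ m.-1 ->
  char_poly B = \prod_(i < m) ('X - ((b i)%:C)%:P) ->
  char_poly C = \prod_(i < m) ('X - ((- c i)%:C)%:P) ->
  \sum_i c i - \sum_i b i = a1 + m.-1%:R * a2.
Proof.
move=> m0 ABC hA hB hC.
have trA : \tr A = (a1 + m.-1%:R * a2)%:C.
  rewrite (@trace_of_roots _ _ _ (a1%:C :: nseq m.-1 a2%:C))//.
  - by rewrite big_cons big_nseq iter_addr_0 mulr_natl rmorphD rmorphMn.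
  - by rewrite /= size_nseq prednK.
  - by rewrite hA big_cons big_nseq -Monoid.iteropE.
have trP (D : 'M[R[i]]_m) (x : 'I_m -> R) :
    char_poly D = \prod_(i < m) ('X - ((x i)%:C)%:P) -> \tr D = (\sum_i x i)%:C.
  move=> hD; rewrite (@trace_of_roots _ _ _ [seq (x i)%:C | i <- enum 'I_m])//.
  - by rewrite big_map big_enum rmorph_sum.
  - by rewrite size_map size_enum_ord.
  - by rewrite big_map big_enum.
have := congr1 mxtrace ABC; rewrite !mxtraceD mxtrace0 trA (trP _ _ hB) (trP _ _ hC).
rewrite -!rmorphD => /(congr1 (@complex.Re R)) /=; rewrite sumrN.
by move: (\sum_i b i) (\sum_i c i) => x y; lra.
Qed.

Theorem theorem1p7 (R : realType) (m : nat) (hm : (1 < m)%N)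
  (A B C : 'M[R[i]]_m) (a1 a2 : R) (b c : 'I_m -> R)
  (hABC : A + B + C = 0)
  (hrankB : \rank B = m) (hrankC : \rank C = m)
  (hAdiag : diagonalizable A) (ha : a1 != a2)
  (hA : char_poly A = ('X - (a1%:C)%:P) * ('X - (a2%:C)%:P) ^+ m.-1)
  (hB : char_poly B = \prod_(i < m) ('X - ((b i)%:C)%:P))
  (hC : char_poly C = \prod_(i < m) ('X - ((- c i)%:C)%:P))
  (hgen : generic_exponents a1 a2 b c)
  (M0 M1 Moo : solution A B -> solution A B)
  (hM0 : monodromy_operator loop0 M0)
  (hM1 : monodromy_operator loop1 M1)
  (hMoo : monodromy_operator loopoo Moo)
  (p q : 'I_m -> solution A B) (r : solution A B)
  (hp : forall i, eigenvector_of M0 (expi (2 * pi * b i)) (p i))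
  (hq : forall i, eigenvector_of Moo (expi (- (2 * pi * c i))) (q i))
  (hr : eigenvector_of M1 (expi (2 * pi * a1)) r)
  (hpr : \sum_(i < m) p i = r) (hqr : \sum_(i < m) q i = r) :
  exists h : hermitian_product (solution A B),
    [/\ [/\ invariant_under h M0, invariant_under h M1
          & invariant_under h Moo],
        forall i j, h (p i) (p j) = (if i == j then nu2_trig a2 b c i else 0)%:C,
        forall i j, h (q i) (q j) = (if i == j then mu2_trig a2 b c i else 0)%:C
      & forall h' : hermitian_product (solution A B),
          [/\ invariant_under h' M0, invariant_under h' M1
            & invariant_under h' Moo] ->
          orthogonal_family h' p -> orthogonal_family h' q ->
          exists k : R, forall u v, h' u v = k%:C * h u v].
Proof.
have m0 : (0 < m)%N by exact: ltnW.
have [a12_nint b_nint c_nint _ abc_nint] := hgen.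
have a12C : a1%:C != a2%:C :> R[i] by rewrite (inj_eq (@complexI _)).
have [A_split rkA] := diagonalizable_two_eigenvalues a12C hAdiag hA.
have linM0 := monodromy_linear regular_loop0 loop0_0 loop0_1 hM0.
have linM1 := monodromy_linear regular_loop1 loop1_0 loop1_1 hM1.
have Moo_inv := monodromy_infinity hM0 hM1 hMoo.
have sum_cb := exponent_trace m0 hABC hA hB hC.
pose be i : R[i] := expi (2 * pi * b i).
pose g i : R[i] := expi (2 * pi * c i).
pose al1 : R[i] := expi (2 * pi * a1).
pose al2 : R[i] := expi (2 * pi * a2).
have expi_unit x : expi x * Num.conj (expi x) = 1 :> R[i].
  by rewrite -normCK normcEC normc_expi expr1n.
have be_inj : injective be.
  move=> i j /expi_eq bij; apply/eqP; apply: contraT => ij.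
  by move: (b_nint i j ij); rewrite bij.
have g_inj : injective g.
  move=> i j /expi_eq cij; apply/eqP; apply: contraT => ij.
  by move: (c_nint i j ij); rewrite cij.
have [co [pE co_p surj]] := free_coordinates (ev := @base_value R m A B)
  base_value_inj (eigenvectors_free linM0 be_inj hp).
have i0 : 'I_m := Ordinal m0.
have [l M1E] := monodromy_reflection A_split rkA a12_nint hM1 surj hr.1 hr.2.
rewrite -hpr in M1E.
have al12 : al1 != al2 by apply: contraNneq a12_nint => /expi_eq.
have M1r : M1 (\sum_i p i) = al1 *: \sum_i p i by rewrite hpr hr.2.
have linl := reflection_functional_linear i0 co_p M1E linM1.
have co_r_ := co_r co_p.
have coM1_ := coM1 co_p M1E.
have M0p i : M0 (p i) = be i *: p i := (hp i).2.
have coM0_ f i := coM0 pE co_p f i linM0 M0p.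
have M1M0q j : M1 (M0 (q j)) = g j *: q j.
  have := Moo_inv (q j); rewrite (hq j).2 (linear_mapZ linM0) (linear_mapZ linM1).
  by move=> E; rewrite -{2}E scalerA expiN mulfV ?expi_neq0// scale1r.
pose Y i : R[i] := expi (2 * pi * (a2 + b i)).
have YE i : Y i = al2 * be i by rewrite /Y mulrDr expiD.
have Y_inj : injective Y.
  by move=> i j; rewrite !YE => /(mulfI (expi_neq0 _))/be_inj.
have gY i j : g j - Y i != 0.
  rewrite subr_eq0 eq_sym; apply: contraNneq (abc_nint i j) => /expi_eq.
  by [].
(* With x the i-th coordinate of q_j, that of M1 M0 q_j = g_j q_j reads Y_i x + s_j = g_j x. *)
pose s j := l (M0 (q j)).
have xE i j : co (q j) i 0 = s j / (g j - Y i).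
  apply/eqP; rewrite eq_sym -[_ == _](inj_eq (mulIf (gY i j))) divfK//.
  have := coM1_ (M0 (q j)) i; rewrite M1M0q linearZ mxE coM0_ => E.
  by rewrite mulrBr [_ * g j]mulrC E YE /s /al2; apply/eqP; ring.
(* The q_j sum to r, whose coordinates are all 1. *)
have sum_s i : \sum_j s j / (g j - Y i) = 1.
  rewrite -(co_r_ i) hpr -hqr linear_sum summxE.
  by apply: eq_bigr => j _; rewrite xE.
have s_neq0 j : s j != 0.
  apply: contra_neq (hq j).1 => sj; rewrite (pE (q j)) big1// => i _.
  by rewrite xE sj mul0r scale0r.
have l_sum f : l f = \sum_i co f i 0 * l (p i).
  by rewrite {1}(pE f) (linear_map_comb (linl : linear (l : _ -> R[i]^o))).
pose w i := be i * l (p i).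
(* Expanding s_j = l(M0 q_j) in coordinates and dividing by s_j gives a second Cauchy system with
   the two families of nodes exchanged, hence the sign. *)
have sum_w j : \sum_i - w i / (Y i - g j) = 1.
  apply: (mulfI (s_neq0 j)); rewrite mulr1 [RHS]l_sum mulr_sumr.
  apply: eq_bigr => i _; rewrite coM0_ xE /w -[Y i - g j]opprB invrN mulrNN.
  ring.
have sP j := cauchy_solution Y_inj gY sum_s j.
have Yg i j : Y j - g i != 0 by rewrite -opprB oppr_eq0.
have wP i := cauchy_solution g_inj Yg sum_w i.
(* The factor that [trig_ratio] leaves: by the trace relation the phase of -w_i is 2 pi b_i + pi (a1
   + a2), and its first part cancels against be_i. *)
pose kappa : R[i] := - ((0 +i* 2) * expi (pi * (a1 + a2))).
have kappa0 : kappa != 0.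
  by rewrite oppr_eq0 mulf_neq0 ?expi_neq0// eq_complex /= eqxx pnatr_eq0.
have mE (x : R) : m%:R * x = x + m.-1%:R * x.
  by rewrite -{1}(prednK m0) -natr1 mulrDl mul1r addrC.
have sum_ab : \sum_i (a2 + b i) = m%:R * a2 + \sum_i b i.
  by rewrite big_split /= sumr_const card_ord mulr_natl.
have lpE i : l (p i) = kappa * (nu2_trig a2 b c i)%:C.
  have nz k : k != i -> a2 + b i - (a2 + b k) \isn't a Num.int.
    by move=> ki; rewrite opprD addrACA subrr add0r b_nint// eq_sym.
  have W := trig_ratio (z := fun k => a2 + b k) (erefl (a2 + b i)) nz (wP i).
  apply: (mulfI (expi_neq0 (2 * pi * b i))); rewrite -/(be i) -/(w i).
  apply: oppr_inj; rewrite W.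
  rewrite /kappa mulNr mulrN opprK.
  have -> : pi * (2 * (a2 + b i) + (\sum_k c k - \sum_k (a2 + b k))) =
     2 * pi * b i + pi * (a1 + a2).
    have -> : \sum_k c k = \sum_k b k + (a1 + m.-1%:R * a2).
      by rewrite -sum_cb subrKC.
    by rewrite sum_ab mE; ring.
  rewrite expiD /nu2_trig /be.
  have -> : \prod_(k < m | k != i) sin (pi * (a2 + b i - (a2 + b k))) =
      \prod_(k < m | k != i) sin (pi * (b i - b k)).
    by apply: eq_bigr => k _; congr (sin (_ * _)); ring.
  ring.
have sE i : s i = - ((0 +i* 2) * expi (pi * (2 * c i + a2 - a1))) *
    (mu2_trig a2 b c i)%:C.
  have nz k : k != i -> c i - c k \isn't a Num.int.
    by move=> ki; rewrite c_nint// eq_sym.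
  rewrite (trig_ratio (erefl (c i)) nz (sP i)).
  have -> : pi * (2 * c i + (\sum_k (a2 + b k) - \sum_k c k)) =
      pi * (2 * c i + a2 - a1).
    have -> : \sum_k c k = \sum_k b k + (a1 + m.-1%:R * a2).
      by rewrite -sum_cb subrKC.
    by rewrite sum_ab mE; congr (_ * _); ring.
  rewrite mulNr -mulrN -rmorphN; congr (_ * _%:C).
  (* The sines of mu_i^2 have opposite arguments: m signs above and m - 1 below leave one. *)
  have oppsin (P : pred 'I_m) (x y : 'I_m -> R) :
      \prod_(k | P k) sin (pi * (x k - y k)) =
      (-1) ^+ #|P| * \prod_(k | P k) sin (pi * (y k - x k)).
    rewrite -prodr_const -big_split; apply: eq_bigr => k _ /=.
    by rewrite -[x k - y k]opprB mulrN sinN mulN1r.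
  rewrite (oppsin _ (fun=> c i)) [X in _ / X](oppsin _ (fun=> c i)) /mu2_trig.
  have -> : #|(fun k : 'I_m => k != i)| = m.-1.
    by have := cardC1 i; rewrite card_ord => <-; apply: eq_card.
  have -> : #|(fun=> true) : pred 'I_m| = m by rewrite -[RHS]card_ord; apply: eq_card.
  rewrite -{1}(prednK m0) exprS mulN1r !mulNr; congr (- _).
  by rewrite invfM mulrACA divff ?mul1r// expf_neq0// oppr_eq0 oner_eq0.
have inv0 := diag_form_M0 (nu2_trig a2 b c) pE co_p linM0 M0p (fun i => expi_unit _).
have inv1 := diag_form_M1 i0 pE co_p M1E linM1 M1r al12 (expi_unit _) (expi_unit _) lpE.
pose h : hermitian_product (solution A B) := diag_form (nu2_trig a2 b c) co.
have invoo : invariant_under h Moo.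
  by move=> u v; rewrite -[LHS]inv0 -[LHS]inv1 !Moo_inv.
(* As r has coordinates 1, kappa h(f, r) = l(f). The value l(q_i) follows from s_i, because l (M1 f)
   = al1 l f and M1 M0 q_i = g_i q_i. *)
have hqr_ i : h (q i) r = (mu2_trig a2 b c i)%:C.
  have lq : l (q i) = kappa * h (q i) r.
    rewrite [LHS](reflection_functionalE i0 pE co_p M1E linM1 lpE) -hpr.
    congr (_ * _); apply: eq_bigr => k _.
    by rewrite co_r_ rmorph1 mulr1.
  have als : al1 * s i = g i * l (q i).
    have lM1 f : l (M1 f) = al1 * l f.
      have lr : l (\sum_i p i) = al1 - al2.
        have := coM1_ (\sum_i p i) i0.
        rewrite M1r linearZ mxE co_r_ !mulr1 => ->.
        by rewrite addrAC subrr add0r.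
      have := linl (l f) (\sum_i p i) (al2 *: f); rewrite addrC -M1E => ->.
      have l0 : l 0 = 0 := linear_map0 (linl : linear (l : _ -> R[i]^o)).
      by have := linl al2 f 0; rewrite !addr0 l0 addr0 lr => ->; ring.
    rewrite -lM1 M1M0q.
    exact: (linear_mapZ (linl : linear (l : _ -> R[i]^o))).
  apply: (mulfI kappa0); rewrite -lq; apply: (mulfI (expi_neq0 (2 * pi * c i))).
  rewrite -/(g i) -als sE /kappa !mulNr !mulrN; congr (- _).
  rewrite !mulrA; congr (_ * _).
  have -> : al1 * (0 +i* 2) * expi (pi * (2 * c i + a2 - a1)) =
      (0 +i* 2) * (al1 * expi (pi * (2 * c i + a2 - a1))) by ring.
  have -> : g i * (0 +i* 2) * expi (pi * (a1 + a2)) =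
      (0 +i* 2) * (g i * expi (pi * (a1 + a2))) by ring.
  by rewrite -!expiD; congr (_ * expi _); ring.
(* If the product were nonzero, invariance under [Moo] would force the eigenvalues of q_i and q_j,
   of modulus 1, to coincide. *)
have horth i j : i != j -> h (q i) (q j) = 0.
  move=> ij; apply/eqP; apply: contraT => hij.
  have := invoo (q i) (q j); rewrite (hq i).2 (hq j).2 hermZl hermZr mulrA.
  rewrite -[RHS]mul1r => /(mulIf hij).
  rewrite -(expi_unit (- (2 * pi * c j))).
  have cj0 : Num.conj (expi (- (2 * pi * c j))) != 0 :> R[i].
    by rewrite conjC_eq0 expi_neq0.
  move=> /(mulIf cj0); rewrite !expiN => /invr_inj/g_inj ij'.
  by rewrite ij' eqxx in ij.
exists h; split => //.
- by move=> i j; exact: diag_form_p.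
- move=> i j; case: eqVneq => [<-|ij]; last by rewrite horth.
  rewrite -hqr_ -hqr herm_sumr (bigD1 i)//= big1 ?addr0// => k ki.
  by rewrite horth// eq_sym.
move=> h' [_ h'1 _] orthp _.
exact: (invariant_form_unique i0 pE co_p M1E linM1 M1r al12 (expi_unit _) lpE
  kappa0 h'1 orthp).
Qed.
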